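(* Let $\overline B$ be a graded connected unshuffle bialgebra over $k$ and $A$ a unital commutative $k$-algebra. For $\gamma_1,\gamma_2\in g_B(A)$ put $$\gamma_1\#\gamma_2:=\log^\prec\big(\mathcal E_\prec(\gamma_1)*\mathcal E_\prec(\gamma_2)\big),\qquad \gamma_1\odot\gamma_2:=\log^\succ\big(\mathcal E_\succ(\gamma_1)*\mathcal E_\succ(\gamma_2)\big).$$ Then $$\gamma_1\#\gamma_2=W\big(\mathrm{BCH}(\Omega'(\gamma_1),\Omega'(\gamma_2))\big),$$ $$\gamma_1\odot\gamma_2=-\big((-\gamma_2)\#(-\gamma_1)\big).$$
   Context: $k$ is a field of characteristic zero. A graded connected unshuffle bialgebra is a graded unital counital bialgebra $\overline B=k\mathbf 1\oplus B$, $B=\bigoplus_{n\ge1}B_n$, with product $\cdot_B$ and coassociative coproduct $\Delta(c)=\bar\Delta(c)+c\otimes\mathbf 1+\mathbf 1\otimes c$ ($c\in B$), together with a splitting $\bar\Delta=\Delta_\prec+\Delta_\succ$ into graded linear maps $B\to B\otimes B$ such that $(\Delta_\prec\otimes\mathrm{id})\Delta_\prec=(\mathrm{id}\otimes\bar\Delta)\Delta_\prec$, $(\Delta_\succ\otimes\mathrm{id})\Delta_\prec=(\mathrm{id}\otimes\Delta_\prec)\Delta_\succ$, $(\bar\Delta\otimes\mathrm{id})\Delta_\succ=(\mathrm{id}\otimes\Delta_\succ)\Delta_\succ$, and, with $\Delta^+_\prec(a):=\Delta_\prec(a)+a\otimes\mathbf 1$, $\Delta^+_\succ(a):=\Delta_\succ(a)+\mathbf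 1\otimes a$, such that $\Delta^+_\prec(a\cdot_Bb)=\Delta^+_\prec(a)\cdot_B\Delta(b)$ and $\Delta^+_\succ(a\cdot_Bb)=\Delta^+_\succ(a)\cdot_B\Delta(b)$ for $a,b\in B$. For a unital commutative $k$-algebra $A$ with product $m_A$: $e:\overline B\to k\to A$ is the augmentation (unital on $k\mathbf 1$, zero on $B$); $f*g:=m_A(f\otimes g)\Delta$ for $f,g\in\mathrm{Lin}(\overline B,A)$, with unit $e$; $f\prec g:=m_A(f\otimes g)\Delta_\prec$ and $f\succ g:=m_A(f\otimes g)\Delta_\succ$ for $f,g\in\mathrm{Lin}(B,A)$ (viewed as the linear maps on $\overline B$ vanishing on $\mathbf 1$), extended bilinearly by $e\succ f=f=f\prec e$, $e\prec f=0=f\succ e$. $G_B(A)$ is the group (under $*$) of characters, i.e. unital algebra maps $\overline B\to A$. $g_B(A)$ is the space of infinitesimal characters, i.e. linear $\kappa:\overline B\to A$ with $\kappa(\mathbf 1)=0$ and $\kappa(a\cdot_Bb)=0$ for $a,b\in B$. For $\alpha\in g_B(A)$: $\mathcal E_\prec(\alpha):=e+\sum_{n>0}\alpha^{\prec n}$ with $\alpha^{\prec 1}=\alpha$, $\alpha^{\prec n}=\alpha\prec\alpha^{\prec n-1}$, and $\mathcal E_\succ(\alpha):=e+\sum_{n>0}\alpha^{\succ n}$ with $\alpha^{\succ1}=\alpha$, $\alpha^{\succ n}=\alpha^{\succ n-1}\succ\alpha$; both maps are bijections $g_B(A)\to G_B(A)$ with inverses $\log^\prec(\Phi)=(\Phi-e)\prec\Phi^{-1}$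 and $\log^\succ(\Phi)=\Phi^{-1}\succ(\Phi-e)$. Also $\exp^*(\alpha):=e+\sum_{n>0}\alpha^{*n}/n!$ is a bijection $g_B(A)\to G_B(A)$ with inverse $\log^*(e+\alpha)=-\sum_{n>0}(-1)^n\alpha^{*n}/n$, and $\mathrm{BCH}(\gamma_1,\gamma_2):=\log^*(\exp^*(\gamma_1)*\exp^*(\gamma_2))$. Pre-Lie product: $f\rhd g:=f\succ g-g\prec f$ and $L_{f\rhd}(g):=f\rhd g$ on $\mathrm{Lin}(B,A)$. $W(\alpha):=\sum_{n\ge0}\frac1{(n+1)!}L_{\alpha\rhd}^n(\alpha)$, and $\Omega'(\alpha)$ is the unique solution $X$ of $X=\sum_{m\ge0}\frac{B_m}{m!}L_{X\rhd}^m(\alpha)$ ($B_m$ the Bernoulli numbers, $B_1=-\frac12$); $\Omega'$ and $W$ are mutually inverse bijections of $g_B(A)$. *)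

(* Defs.v *)
From HB Require Import structures.
From mathcomp Require Import all_boot all_order all_algebra generic_quotient.
From mathcomp Require Import all_classical.

Set Implicit Arguments.
Unset Strict Implicit.
Unset Printing Implicit Defensive.

Import GRing.Theory.
Local Open Scope ring_scope.
Local Open Scope quotient_scope.
Local Open Scope classical_set_scope.

Reserved Notation "v \ox w" (at level 40, left associativity).

(** * Tensor product of two vector spaces

  A formal sum of pure tensors is a sequence of pairs, and the tensor product
  is the quotient of the monoid of formal sums by the congruence generated by
  commutativity and by the bilinearity relations. The scalar of a term is
  absorbed in its left factor. *)

Section TensorCongruence.
Variables (k : fieldType) (V W : lmodType k).

Inductive tens_cong : seq (V * W) -> seq (V * W) -> Prop :=
| tens_cong_refl s : tens_cong s s
| tens_cong_sym s t : tens_cong s t -> tens_cong t s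
| tens_cong_trans s t u : tens_cong s t -> tens_cong t u -> tens_cong s u
| tens_cong_cat s s' t t' :
    tens_cong s s' -> tens_cong t t' -> tens_cong (s ++ t) (s' ++ t')
| tens_cong_catC s t : tens_cong (s ++ t) (t ++ s)
| tens_cong_addl v v' w : tens_cong [:: (v + v', w)] [:: (v, w); (v', w)]
| tens_cong_addr v w w' : tens_cong [:: (v, w + w')] [:: (v, w); (v, w')]
| tens_cong_scale a v w : tens_cong [:: (a *: v, w)] [:: (v, a *: w)]
| tens_cong_0 w : tens_cong [:: (0, w)] [::].

Definition tens_rel : rel (seq (V * W)) := fun s t => `[< tens_cong s t >].

Lemma tens_rel_refl : reflexive tens_rel.
Proof. by move=> s; apply/asboolP; exact: tens_cong_refl. Qed.

Lemma tens_rel_sym : symmetric tens_rel.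
Proof. by move=> s t; apply/asboolP/asboolP; exact: tens_cong_sym. Qed.

Lemma tens_rel_trans : transitive tens_rel.
Proof.
by move=> t s u /asboolP st /asboolP tu; apply/asboolP; exact: tens_cong_trans tu.
Qed.

Canonical tens_equiv := EquivRel tens_rel tens_rel_refl tens_rel_sym tens_rel_trans.

Definition tens := {eq_quot tens_equiv}.
HB.instance Definition _ := Choice.on tens.
HB.instance Definition _ := EqQuotient.on tens.

Definition tens_class (s : seq (V * W)) : tens := \pi_tens s.

Lemma tens_classP s t : tens_class s = tens_class t <-> tens_cong s t.
Proof. by split=> [/eqmodP/asboolP|st]; [|apply/eqmodP/asboolP]. Qed.

Lemma tens_cong_map (a : k) s t : tens_cong s t ->
  tens_cong [seq (a *: p.1, p.2) | p <- s] [seq (a *: p.1, p.2) | p <- t].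
Proof.
elim=> {s t} /=.
- by move=> s; exact: tens_cong_refl.
- by move=> s t _; exact: tens_cong_sym.
- by move=> s t u _ + _; exact: tens_cong_trans.
- by move=> s s' t t' _ + _ +; rewrite !map_cat; exact: tens_cong_cat.
- by move=> s t; rewrite !map_cat; exact: tens_cong_catC.
- by move=> v v' w; rewrite scalerDr; exact: tens_cong_addl.
- by move=> v w w'; exact: tens_cong_addr.
- by move=> b v w; rewrite scalerA mulrC -scalerA; exact: tens_cong_scale.
- by move=> w; rewrite scaler0; exact: tens_cong_0.
Qed.

Definition tens_add (x y : tens) : tens := tens_class (repr x ++ repr y).
Definition tens_scale (a : k) (x : tens) : tens :=
  tens_class [seq (a *: p.1, p.2) | p <- repr x].

Lemma tens_class_repr (x : tens) : tens_class (repr x) = x.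
Proof. exact: reprK. Qed.

Lemma tens_repr_class s : tens_cong (repr (tens_class s)) s.
Proof. by apply/tens_classP; rewrite tens_class_repr. Qed.

Lemma tens_addE s t : tens_add (tens_class s) (tens_class t) = tens_class (s ++ t).
Proof. by apply/tens_classP/tens_cong_cat; exact: tens_repr_class. Qed.

Lemma tens_scaleE a s : tens_scale a (tens_class s) =
  tens_class [seq (a *: p.1, p.2) | p <- s].
Proof. by apply/tens_classP/tens_cong_map; exact: tens_repr_class. Qed.

Lemma tens_ind (P : tens -> Prop) : (forall s, P (tens_class s)) -> forall x, P x.
Proof. by move=> Ps x; rewrite -(tens_class_repr x). Qed.

Lemma tens_addA : associative tens_add.
Proof.
elim/tens_ind=> s; elim/tens_ind=> t; elim/tens_ind=> u.
by rewrite !tens_addE catA.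
Qed.

Lemma tens_addC : commutative tens_add.
Proof.
elim/tens_ind=> s; elim/tens_ind=> t.
by rewrite !tens_addE; apply/tens_classP; exact: tens_cong_catC.
Qed.

Lemma tens_add0 : left_id (tens_class [::]) tens_add.
Proof. by elim/tens_ind=> s; rewrite tens_addE. Qed.

Lemma tens_scaleDl (x : tens) (a b : k) :
  tens_scale (a + b) x = tens_add (tens_scale a x) (tens_scale b x).
Proof.
have consE p s : tens_class (p :: s) = tens_add (tens_class [:: p]) (tens_class s).
  by rewrite tens_addE.
have addACA : interchange tens_add tens_add.
  by move=> p q r s; rewrite -!tens_addA (tens_addA q) (tens_addC q) -tens_addA.
elim/tens_ind: x => s; rewrite !tens_scaleE.
elim: s => [|[v w] s IHs] /=; first by rewrite tens_add0.
rewrite consE IHs (consE (a *: v, w)) (consE (b *: v, w)) addACA; congr tens_add.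
by rewrite tens_addE scalerDl; apply/tens_classP; exact: tens_cong_addl.
Qed.

Lemma tens_scale0 (x : tens) : tens_scale 0 x = tens_class [::].
Proof.
elim/tens_ind: x => s; rewrite !tens_scaleE; apply/tens_classP.
elim: s => [|[v w] s IHs] /=; first exact: tens_cong_refl.
rewrite scale0r -cat1s -[X in tens_cong _ X]cat0s.
by apply: tens_cong_cat IHs; exact: tens_cong_0.
Qed.

Lemma tens_scale1 : left_id 1 tens_scale.
Proof.
elim/tens_ind=> s; rewrite tens_scaleE -[in RHS](map_id s).
by congr tens_class; apply: eq_map => -[v w] /=; rewrite scale1r.
Qed.

Lemma tens_addN : left_inverse (tens_class [::]) (tens_scale (-1)) tens_add.
Proof.
by move=> x; rewrite -{2}(tens_scale1 x) -tens_scaleDl addNr tens_scale0.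
Qed.

HB.instance Definition _ :=
  GRing.isZmodule.Build tens tens_addA tens_addC tens_add0 tens_addN.

Lemma tens_scaleA a b (x : tens) :
  tens_scale a (tens_scale b x) = tens_scale (a * b) x.
Proof.
elim/tens_ind: x => s; rewrite !tens_scaleE -map_comp.
by congr tens_class; apply: eq_map => -[v w] /=; rewrite scalerA.
Qed.

Lemma tens_scaleDr : right_distributive tens_scale +%R.
Proof.
move=> a; elim/tens_ind=> s; elim/tens_ind=> t.
by rewrite [_ + _]tens_addE !tens_scaleE [RHS]tens_addE map_cat.
Qed.

HB.instance Definition _ := GRing.Zmodule_isLmodule.Build k tens
  tens_scaleA tens_scale1 tens_scaleDr tens_scaleDl.

Definition pure_tens (v : V) (w : W) : tens := tens_class [:: (v, w)].

End TensorCongruence.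

Notation "v \ox w" := (pure_tens v w) : ring_scope.

(** Every formula involving [tlift f] below has [f] bilinear; [tlift f] is then
  the linear map induced by [f], see [tlift_pure], [tlift_linear] and
  [tlift_unique]. For other [f] its value depends on representatives. *)
Section TensorLift.
Variables (k : fieldType) (V W U : lmodType k).

Definition tlift (f : V -> W -> U) (t : tens V W) : U :=
  \sum_(p <- repr t) f p.1 p.2.

Lemma tens_class_sum (s : seq (V * W)) :
  tens_class s = \sum_(p <- s) p.1 \ox p.2.
Proof.
elim: s => [|[v w] s IHs]; first by rewrite big_nil.
by rewrite big_cons -IHs /= /pure_tens [RHS]tens_addE.
Qed.

Lemma pure_tens_linearl (w : W) : linear (fun v : V => v \ox w).
Proof.
move=> a v v'; rewrite [a *: (v \ox w)]tens_scaleE [RHS]tens_addE.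
by apply/tens_classP; exact: tens_cong_addl.
Qed.

Lemma pure_tens_linearr (v : V) : linear (fun w : W => v \ox w).
Proof.
move=> a w w'; rewrite [a *: (v \ox w)]tens_scaleE [RHS]tens_addE; apply/tens_classP.
apply: tens_cong_trans (tens_cong_addr _ _ _) _.
rewrite -[[:: _; _]]/([:: _] ++ [:: _]) -[X in tens_cong _ X]/([:: _] ++ [:: _]).
apply: tens_cong_cat; last exact: tens_cong_refl.
by apply: tens_cong_sym; exact: tens_cong_scale.
Qed.

Variable f : V -> W -> U.
Hypothesis f_linl : forall w, linear (f^~ w).
Hypothesis f_linr : forall v, linear (f v).

Lemma tlift_class s : tlift f (tens_class s) = \sum_(p <- s) f p.1 p.2.
Proof.
have f0 w : f 0 w = 0.
  by have := f_linl w (-1) 0 0; rewrite scaleN1r oppr0 addr0 scaleN1r addNr.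
have fr0 v : f v 0 = 0.
  by have := f_linr v (-1) 0 0; rewrite scaleN1r oppr0 addr0 scaleN1r addNr.
have fZl a v w : f (a *: v) w = a *: f v w.
  by have := f_linl w a v 0; rewrite !addr0 f0 addr0.
have fZr a v w : f v (a *: w) = a *: f v w.
  by have := f_linr v a w 0; rewrite !addr0 fr0 addr0.
suff cong_sum t u : tens_cong t u ->
    \sum_(p <- t) f p.1 p.2 = \sum_(p <- u) f p.1 p.2.
  exact/cong_sum/tens_repr_class.
elim=> {s t u} //=.
- by move=> t u r _ -> _.
- by move=> t t' u u' _ + _ +; rewrite !big_cat => -> ->.
- by move=> t u; rewrite !big_cat /= addrC.
- move=> v v' w; rewrite !big_cons big_nil /= !addr0.
  by have := f_linl w 1 v v'; rewrite !scale1r.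
- move=> v w w'; rewrite !big_cons big_nil /= !addr0.
  by have := f_linr v 1 w w'; rewrite !scale1r.
- by move=> a v w; rewrite !big_cons !big_nil /= fZl fZr.
- by move=> w; rewrite big_cons !big_nil f0 addr0.
Qed.

Lemma tlift_pure v w : tlift f (v \ox w) = f v w.
Proof. by rewrite tlift_class big_cons big_nil addr0. Qed.

Lemma tlift_linear : linear (tlift f).
Proof.
move=> a; elim/tens_ind=> s; elim/tens_ind=> t.
rewrite [a *: tens_class s]tens_scaleE [_ + tens_class t]tens_addE !tlift_class.
rewrite big_cat big_map scaler_sumr; congr (_ + _); apply: eq_bigr => -[v w] _ /=.
have := f_linl w a v 0; have := f_linl w (-1) 0 0.
by rewrite scaleN1r oppr0 addr0 scaleN1r addNr addr0 => ->; rewrite addr0.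
Qed.

Lemma tlift_unique (g : {linear tens V W -> U}) :
  (forall v w, g (v \ox w) = f v w) -> forall t, g t = tlift f t.
Proof.
move=> gf; elim/tens_ind=> s.
by rewrite tlift_class tens_class_sum linear_sum; apply: eq_bigr => p _.
Qed.

End TensorLift.

Definition tmap (k : fieldType) (V W V' W' : lmodType k)
    (f : V -> V') (g : W -> W') : tens V W -> tens V' W' :=
  tlift (fun v w => f v \ox g w).

Definition tassoc (k : fieldType) (U V W : lmodType k) :
    tens (tens U V) W -> tens U (tens V W) :=
  tlift (fun t w => tlift (fun u v => u \ox (v \ox w)) t).

Definition tmul (k : fieldType) (R S : algType k) (x y : tens R S) : tens R S :=
  tlift (fun a b => tlift (fun c d => (a * c) \ox (b * d)) y) x.

Definition tspan (k : fieldType) (V W : lmodType k) (P : V -> W -> Prop) :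
    set (tens V W) :=
  [set t | exists2 s : seq (V * W),
     (forall p, p \in s -> P p.1 p.2) & t = \sum_(p <- s) p.1 \ox p.2].

(** * Unshuffle bialgebras *)

Definition is_grading (k : fieldType) (V : lmodType k) (G : nat -> {pred V}) :=
  [/\ forall n, GRing.submod_closed (G n),
      forall x, exists (N : nat) (y : nat -> V),
        (forall i, y i \in G i) /\ x = \sum_(i < N) y i
    & forall (N : nat) (y : nat -> V), (forall i, y i \in G i) ->
        \sum_(i < N) y i = 0 -> forall i, (i < N)%N -> y i = 0].

(** [B] is the whole bialgebra (with unit), [us_gr 0] being the line of the unit
  and the augmentation ideal, the direct sum of the [us_gr n] for [0 < n], being
  the kernel of the counit (see [us_counit_eq0]). The half-coproducts are only
  relevant on the augmentation ideal; they are encoded as linear maps on [B]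
  that vanish at 1. *)
Record unshuffle_bialg (k : fieldType) (B : algType k) := UnshuffleBialg {
  us_gr : nat -> {pred B};
  us_counit : {scalar B};
  us_cop : {linear B -> tens B B};
  us_prec : {linear B -> tens B B};
  us_succ : {linear B -> tens B B};

  us_grP : is_grading us_gr;
  us_gr0P : forall x, x \in us_gr 0 <-> exists a : k, x = a%:A;
  us_grM : forall m n x y,
    x \in us_gr m -> y \in us_gr n -> x * y \in us_gr (m + n);

  us_counit1 : us_counit 1 = 1;
  us_counitM : forall x y, us_counit (x * y) = us_counit x * us_counit y;
  us_counit_gr : forall n x, x \in us_gr n.+1 -> us_counit x = 0;

  us_cop1 : us_cop 1 = 1 \ox 1;
  us_copM : forall x y, us_cop (x * y) = tmul (us_cop x) (us_cop y);
  us_copA : forall x, tassoc (tmap us_cop idfun (us_cop x)) =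
                      tmap idfun us_cop (us_cop x);
  us_cop_counitl : forall x, tlift (fun a b => us_counit a *: b) (us_cop x) = x;
  us_cop_counitr : forall x, tlift (fun a b => us_counit b *: a) (us_cop x) = x;
  us_cop_gr : forall n x, x \in us_gr n ->
    tspan (fun a b => exists i j,
             [/\ (i + j = n)%N, a \in us_gr i & b \in us_gr j]) (us_cop x);

  us_prec1 : us_prec 1 = 0;
  us_succ1 : us_succ 1 = 0;
  us_prec_gr : forall n x, x \in us_gr n.+1 ->
    tspan (fun a b => exists i j,
             [/\ (i.+1 + j.+1 = n.+1)%N, a \in us_gr i.+1 & b \in us_gr j.+1])
          (us_prec x);
  us_succ_gr : forall n x, x \in us_gr n.+1 ->
    tspan (fun a b => exists i j,
             [/\ (i.+1 + j.+1 = n.+1)%N, a \in us_gr i.+1 & b \in us_gr j.+1])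
          (us_succ x);

  us_redcop := (fun x => us_prec x + us_succ x) : B -> tens B B;
  us_copE : forall c, us_counit c = 0 ->
    us_cop c = us_redcop c + c \ox 1 + 1 \ox c;

  us_prec_prec : forall c, us_counit c = 0 ->
    tassoc (tmap us_prec idfun (us_prec c)) = tmap idfun us_redcop (us_prec c);
  us_succ_prec : forall c, us_counit c = 0 ->
    tassoc (tmap us_succ idfun (us_prec c)) = tmap idfun us_prec (us_succ c);
  us_redcop_succ : forall c, us_counit c = 0 ->
    tassoc (tmap us_redcop idfun (us_succ c)) = tmap idfun us_succ (us_succ c);

  us_precp := (fun a => us_prec a + a \ox 1) : B -> tens B B;
  us_succp := (fun a => us_succ a + 1 \ox a) : B -> tens B B;
  us_precpM : forall a b, us_counit a = 0 -> us_counit b = 0 ->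
    us_precp (a * b) = tmul (us_precp a) (us_cop b);
  us_succpM : forall a b, us_counit a = 0 -> us_counit b = 0 ->
    us_succp (a * b) = tmul (us_succp a) (us_cop b)
}.

Lemma us_counit_eq0 (k : fieldType) (B : algType k) (H : unshuffle_bialg B) x :
  us_counit H x = 0 <->
  exists (N : nat) (y : nat -> B),
    (forall i, y i \in us_gr H i.+1) /\ x = \sum_(i < N) y i.
Proof.
split=> [|[N [y [yG ->]]]]; last first.
  by rewrite linear_sum big1 // => i _; exact: us_counit_gr (yG _).
have [_ dec _] := us_grP H; have [N [y [yG ->]]] := dec x.
case: N => [|N]; first by exists 0%N, (fun i => y i.+1); rewrite !big_ord0.
rewrite big_ord_recl linearD linear_sum [X in _ + X]big1 ?addr0 => [|i _].
  have /us_gr0P[a ->] := yG 0%N.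
  rewrite linearZ /= us_counit1 mulr1 => ->; rewrite scale0r add0r.
  by exists N, (fun i => y i.+1); split.
exact: us_counit_gr (yG _).
Qed.

(** * Convolution products

  The elements of Lin(B, A) are represented by plain functions [B -> A], with
  the pointwise vector space structure; linearity is required explicitly in the
  predicates [character], [inf_char] and [lin_aug]. *)

Section Convolution.
Variables (k : fieldType) (B : algType k) (H : unshuffle_bialg B).
Variable A : comAlgType k.
Implicit Types (f g : B -> A) (u : nat -> B -> A).

Definition mulA : tens A A -> A := tlift *%R.

Definition aug : B -> A := fun x => (us_counit H x)%:A.

Definition conv f g : B -> A := fun x => mulA (tmap f g (us_cop H x)).

(** The half-products on the linear maps that vanish at 1. *)
Definition hprec f g : B -> A := fun x => mulA (tmap f g (us_prec H x)).
Definition hsucc f g : B -> A := fun x => mulA (tmap f g (us_succ H x)).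

(** The bilinear extension of the half-products along the decomposition
  [f = f 1 * aug + reduced f], under [aug < g = 0], [f < aug = f],
  [aug > g = g], [f > aug = 0]. *)
Definition reduced f : B -> A := fun x => f x - f 1 * aug x.
Definition xprec f g : B -> A :=
  fun x => hprec (reduced f) (reduced g) x + g 1 * reduced f x.
Definition xsucc f g : B -> A :=
  fun x => hsucc (reduced f) (reduced g) x + f 1 * reduced g x.

Definition lin_aug : set (B -> A) := [set f | linear f /\ f 1 = 0].

Definition character : set (B -> A) :=
  [set f | [/\ linear f, f 1 = 1 & forall x y, f (x * y) = f x * f y]].

Definition inf_char : set (B -> A) :=
  [set f | [/\ linear f, f 1 = 0 &
    forall a b, us_counit H a = 0 -> us_counit H b = 0 -> f (a * b) = 0]].

(** Inverse in the group of characters. *)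
Definition conv_inv f : B -> A :=
  xget aug [set g | [/\ character g, conv f g = aug & conv g f = aug]].

(** The sum of a series of maps, all but finitely many terms of which vanish at
  each given point; all the series below are of this kind by degree reasons. *)
Definition lfsum u : B -> A :=
  fun x => xget 0 [set s | exists N, forall n, (N <= n)%N ->
                             \sum_(i < n) u i x = s].

Lemma lfsumE u x N : (forall n, (N <= n)%N -> u n x = 0) ->
  lfsum u x = \sum_(i < N) u i x.
Proof.
move=> u0; apply: xget_unique => [|s [M sM]]; last first.
  have := sM (M + N)%N (leq_addr _ _); rewrite addnC => <-.
  by rewrite big_split_ord /= [X in _ + X]big1 ?addr0// => i _; rewrite u0 ?leq_addr.
exists N => n /subnKC <-.
by rewrite big_split_ord /= [X in _ + X]big1 ?addr0// => i _; rewrite u0 ?leq_addr.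
Qed.

(** [prec_pow a n] and [succ_pow a n] are the half-product powers of order
  [n.+1]. *)
Definition prec_pow (a : B -> A) (n : nat) : B -> A := iter n (hprec a) a.
Definition succ_pow (a : B -> A) (n : nat) : B -> A := iter n (hsucc^~ a) a.
Definition conv_pow (a : B -> A) (n : nat) : B -> A := iter n (conv a) aug.

Definition Eprec (a : B -> A) : B -> A := aug + lfsum (prec_pow a).
Definition Esucc (a : B -> A) : B -> A := aug + lfsum (succ_pow a).
Definition log_prec (F : B -> A) : B -> A := xprec (F - aug) (conv_inv F).
Definition log_succ (F : B -> A) : B -> A := xsucc (conv_inv F) (F - aug).

Definition conv_exp (a : B -> A) : B -> A :=
  aug + lfsum (fun n => (n.+1`!%:R : k)^-1 *: conv_pow a n.+1).
Definition conv_log (F : B -> A) : B -> A :=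
  - lfsum (fun n => ((-1) ^+ n.+1 / n.+1%:R : k) *: conv_pow (F - aug) n.+1).

Definition BCH (g1 g2 : B -> A) : B -> A :=
  conv_log (conv (conv_exp g1) (conv_exp g2)).

Definition prelie f g : B -> A := hsucc f g - hprec g f.

Definition Wmap (a : B -> A) : B -> A :=
  lfsum (fun n => (n.+1`!%:R : k)^-1 *: iter n (prelie a) a).

End Convolution.

(** The Bernoulli numbers in a field of characteristic zero, with B_1 = -1/2;
  [bernoulli_seq k n] lists the first [n] of them, and the recursion solves
  [bernoulliP] for the last term. *)
Fixpoint bernoulli_seq (k : fieldType) (n : nat) : seq k :=
  if n is m.+1 then
    let s := bernoulli_seq k m in
    rcons s (((m == 0%N)%:R - \sum_(j < m) 'C(m.+1, j)%:R * s`_j) / m.+1%:R)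
  else [::].

Definition bernoulli (k : fieldType) (n : nat) : k := (bernoulli_seq k n.+1)`_n.

Lemma size_bernoulli_seq (k : fieldType) n : size (bernoulli_seq k n) = n.
Proof. by elim: n => //= n IHn; rewrite size_rcons IHn. Qed.

Lemma nth_bernoulli_seq (k : fieldType) n j : (j < n)%N ->
  (bernoulli_seq k n)`_j = bernoulli k j.
Proof.
elim: n => // n IHn; rewrite ltnS leq_eqVlt => /predU1P[-> //|jn].
by rewrite /= nth_rcons size_bernoulli_seq jn IHn.
Qed.

Lemma bernoulliP (k : fieldType) : [pchar k] =i pred0 ->
  forall n, \sum_(j < n.+1) 'C(n.+1, j)%:R * bernoulli k j = (n == 0%N)%:R.
Proof.
move=> k0 n; have n0 : n.+1%:R != 0 :> k by rewrite ((pcharf0P k).1 k0).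
rewrite big_ord_recr /= {2}/bernoulli /= nth_rcons size_bernoulli_seq ltnn eqxx.
rewrite binSn mulrCA divff // mulr1 addrC.
under [X in _ + X]eq_bigr => j _ do rewrite -(nth_bernoulli_seq k (ltn_ord j)).
by rewrite subrK.
Qed.

Section PreLieMagnus.
Variables (k : fieldType) (B : algType k) (H : unshuffle_bialg B).
Variable A : comAlgType k.

(** The unique solution of the fixed point equation in Lin(B, A). *)
Definition Omega' (a : B -> A) : B -> A :=
  xget 0 [set X | lin_aug X /\
    X = lfsum (fun m => (bernoulli k m / m`!%:R) *: iter m (prelie H X) a)].

Definition sharp (g1 g2 : B -> A) : B -> A :=
  log_prec H (conv H (Eprec H g1) (Eprec H g2)).

Definition odot (g1 g2 : B -> A) : B -> A :=
  log_succ H (conv H (Esucc H g1) (Esucc H g2)).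

End PreLieMagnus.

(* Main.v *)
(** The linear maps from B to A form a filtered algebra under convolution, complete
  for the filtration by the degrees on which a map vanishes, and the two
  half-convolutions make it a dendriform algebra. Put l g = b > g and r g = g < b.
  These operators commute and b |> g = (l - r) g, so the binomial theorem gives
  b^(m+1) = sum_(i <= m) C(m+1, i) r^i (l - r)^(m-i) b, which sums up to
  exp b - 1 = W b + W b < (exp b - 1). Hence exp b = E_prec (W b), and, multiplying
  on the right by the inverse F^-1 of F = exp b, log_prec F = W (log F). As
  E_prec g = exp (Omega' g), the first formula follows. The second one comes from
  E_prec (- g) being the inverse of E_succ g, and from the identity
  g + g < f + f + g > f = 0 valid when (1 + g) * (1 + f) = 1.

  The inverses in log_prec and log_succ are taken among characters, so one also
  needs E_prec and E_succ of an infinitesimal character to be characters; this is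
  an induction on the degree of the left factor of a product. *)

Require Import Defs.
From HB Require Import structures.
From mathcomp Require Import all_boot all_order all_algebra.
From mathcomp Require Import all_classical.
From mathcomp Require Import ring.

Set Implicit Arguments.
Unset Strict Implicit.
Unset Printing Implicit Defensive.

Import GRing.Theory.
Local Open Scope ring_scope.

(** * Complete filtered dendriform algebras *)

(** The half-products are defined on the whole unital algebra, but they only split
  the product of elements of [dfil 1]; [dsum u] is a sum for the series of terms
  [u n] as soon as [u n] is in [dfil n] for all [n]. *)
Record dendriform (k : fieldType) (U : algType k) := Dendriform {
  dfil : nat -> {pred U};
  dsum : (nat -> U) -> U;
  dprec : {bilinear U -> U -> U};
  dsucc : {bilinear U -> U -> U};

  dfil_closed : forall n, GRing.submod_closed (dfil n);
  dfil0 : forall f, f \in dfil 0;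
  dfilS : forall n f, f \in dfil n.+1 -> f \in dfil n;
  dfil_sep : forall f, (forall n, f \in dfil n) -> f = 0;
  dfilM : forall m n f g, f \in dfil m -> g \in dfil n -> f * g \in dfil (m + n);
  dfil_prec : forall m n f g,
    f \in dfil m -> g \in dfil n -> dprec f g \in dfil (m + n);
  dfil_succ : forall m n f g,
    f \in dfil m -> g \in dfil n -> dsucc f g \in dfil (m + n);
  dsumP : forall u, (forall n, u n \in dfil n) ->
    forall n, dsum u - \sum_(i < n) u i \in dfil n;

  dmulE : forall f g, f \in dfil 1 -> g \in dfil 1 ->
    f * g = dprec f g + dsucc f g;
  dprecA : forall f g h,
    dprec (dprec f g) h = dprec f (dprec g h + dsucc g h);
  dsuccprecA : forall f g h, dprec (dsucc f g) h = dsucc f (dprec g h);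
  dsuccA : forall f g h,
    dsucc (dprec f g + dsucc f g) h = dsucc f (dsucc g h)
}.

(** * Convergent series in the filtration *)

Section FilteredSums.
Variables (k : fieldType) (U : algType k) (S : dendriform U).
Implicit Types (f g h : U) (u v : nat -> U).
Local Notation F := (dfil S).
Local Notation dsum := (dsum S).

HB.instance Definition _ n :=
  GRing.isSubmodClosed.Build k U (F n) (dfil_closed S n).

Lemma dfil_le m n f : (m <= n)%N -> f \in F n -> f \in F m.
Proof.
move=> /subnK <-; elim: (n - m)%N => // d IHd.
by rewrite addSn => /dfilS.
Qed.

Lemma dfil1X f n : f \in F 1 -> f ^+ n \in F n.
Proof.
move=> f1; elim: n => [|n IHn]; first exact: dfil0.
by rewrite exprS -add1n; exact: dfilM.
Qed.

Lemma dfil1XS f n : f \in F 1 -> f ^+ n.+1 \in F 1.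
Proof. by move=> f1; apply: (@dfil_le _ n.+1) => //; exact: dfil1X. Qed.

Lemma dfil_prec1l n f g : f \in F 1 -> g \in F n -> dprec S f g \in F n.+1.
Proof. by move=> ff gf; rewrite -add1n; exact: dfil_prec. Qed.

Lemma dfil_succ1l n f g : f \in F 1 -> g \in F n -> dsucc S f g \in F n.+1.
Proof. by move=> ff gf; rewrite -add1n; exact: dfil_succ. Qed.

Lemma dfil_prec1r n f g : f \in F n -> g \in F 1 -> dprec S f g \in F n.+1.
Proof. by move=> ff gf; rewrite -addn1; exact: dfil_prec. Qed.

Lemma dfil_succ1r n f g : f \in F n -> g \in F 1 -> dsucc S f g \in F n.+1.
Proof. by move=> ff gf; rewrite -addn1; exact: dfil_succ. Qed.

(** The Banach fixed point argument: [f] climbs the filtration one step at each use of the equation,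
    so it lies in every [F n] and is zero by separatedness. All uniqueness statements below are
    applications of it to a difference or a defect. *)
Lemma dfil_contract (phi : U -> U) f :
  (forall n g, g \in F n -> phi g \in F n.+1) -> f = phi f -> f = 0.
Proof.
move=> phiF fE; apply: (@dfil_sep _ _ S) => n.
by elim: n => [|n IHn]; [exact: dfil0|rewrite fE; exact: phiF].
Qed.

Lemma dsum_unique u s : (forall n, u n \in F n) ->
  (forall n, s - \sum_(i < n) u i \in F n) -> dsum u = s.
Proof.
move=> uF sF; apply/eqP; rewrite -subr_eq0; apply/eqP/(@dfil_sep _ _ S) => n.
rewrite -[_ - s](subrKA (\sum_(i < n) u i)) rpredD//; first exact: dsumP.
by rewrite -opprB rpredN.
Qed.

Lemma dsum_fil u m : (forall n, u n \in F n) -> (forall n, u n \in F m) ->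
  dsum u \in F m.
Proof.
move=> uF um; rewrite -[dsum u](subrK (\sum_(i < m) u i)) rpredD//.
  exact: dsumP.
exact: rpred_sum.
Qed.

(** A linear map respecting the filtration is continuous, since it maps the remainders of the series
    to remainders. *)
Lemma dsum_linear (phi : {linear U -> U}) u :
  (forall n g, g \in F n -> phi g \in F n) -> (forall n, u n \in F n) ->
  phi (dsum u) = dsum (fun n => phi (u n)).
Proof.
move=> phiF uF; apply/esym/dsum_unique => n; first exact/phiF/uF.
by rewrite -raddf_sum -raddfB; apply/phiF/dsumP.
Qed.

Lemma dsum_recl u : (forall n, u n \in F n) ->
  dsum u = u 0%N + dsum (fun n => u n.+1).
Proof.
move=> uF.
have uSF n : u n.+1 \in F n by apply: dfilS; exact: uF.
apply: dsum_unique => // -[|n]; first exact: dfil0.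
rewrite big_ord_recl opprD addrACA subrr add0r /=.
rewrite -[_ - _](subrKA (\sum_(i < n.+1) u i.+1)) rpredD//.
  exact: (dsumP uSF).
by rewrite big_ord_recr /= addrAC subrr add0r.
Qed.

(** The Cauchy product of a series of operators with a series of elements. *)
Lemma dsum_dsum (phi : nat -> {linear U -> U}) u :
  (forall m n g, g \in F n -> phi m g \in F (m + n)) ->
  (forall n, u n \in F n) ->
  dsum (fun n => phi n (dsum u)) =
  dsum (fun n => \sum_(i < n.+1) phi i (u (n - i)%N)).
Proof.
move=> phiF uF; apply: dsum_unique => [n|n].
  by rewrite -[X in F X]addn0; apply: phiF; exact: dfil0.
pose v i j := phi i (u j).
have vF i j : v i j \in F (i + j) by exact/phiF/uF.
have lim : dsum (fun n => \sum_(i < n.+1) v i (n - i)%N) -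
    \sum_(m < n) \sum_(i < m.+1) v i (m - i)%N \in F n.
  apply: dsumP => m; apply: rpred_sum => i _.
  by have := vF i (m - i)%N; rewrite subnKC // -ltnS.
rewrite -[_ - _](subrKA (\sum_(m < n) \sum_(i < m.+1) v i (m - i)%N)) rpredD//.
(* Both double sums run over the triangle i + j < n, sliced by m = i + j on the left and by i on the
   right. *)
have -> : \sum_(m < n) \sum_(i < m.+1) v i (m - i)%N =
          \sum_(i < n) \sum_(j < n - i) v i j.
  transitivity (\sum_(m < n) \sum_(i < n | (i <= m)%N) v i (m - i)%N).
    apply: eq_bigr => m _; rewrite (big_ord_widen n (fun i => v i (m - i)%N)) //.
  rewrite (exchange_big_dep xpredT) //=; apply: eq_bigr => i _.
  rewrite -(big_mkord (fun m => (i <= m)%N) (fun m => v i (m - i)%N)).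
  rewrite (@big_cat_nat _ _ _ i) //=; last exact: ltnW.
  rewrite [X in X + _]big_nat_cond big1 ?add0r; last first.
    by move=> j /andP[/andP[_ ji]]; rewrite leqNgt ji.
  rewrite -{1}[nat_of_ord i]add0n big_addn big_mkord.
  by apply: eq_big => [j|j _]; rewrite ?leq_addl ?addnK.
(* Up to sign, the [i]-th difference is [phi i] of the remainder of order [n - i] of [u], so it has
   filtration degree [n]. *)
rewrite -sumrB; apply: rpred_sum => i _; rewrite -opprB rpredN -raddf_sum -raddfB.
have := phiF i _ _ (dsumP uF (n - i)%N).
by rewrite subnKC // ltnW.
Qed.

End FilteredSums.

(** * Exponentials and logarithms *)

Section Exponentials.
Variables (k : fieldType) (U : algType k) (S : dendriform U).
Implicit Types (a b f g h v : U).
Local Notation F := (dfil S).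
Local Notation dsum := (dsum S).
Local Notation "f '<~' g" := (dprec S f g) (at level 45, left associativity).
Local Notation "f '~>' g" := (dsucc S f g) (at level 45, left associativity).

(** The units are left out: [1 + dEprec a], [1 + dEsucc a] and [1 + dexp b] below are
  the exponentials, and [dlog f] is the logarithm of [1 + f]. *)
Definition dEprec a := dsum (fun n => iter n (dprec S a) a).
Definition dEsucc a := dsum (fun n => iter n (dsucc S ^~ a) a).

Lemma iter_prec_fil a n : a \in F 1 -> iter n (dprec S a) a \in F n.+1.
Proof. by move=> a1; elim: n => //= n; exact: dfil_prec1l. Qed.

Lemma iter_succ_fil a n : a \in F 1 -> iter n (dsucc S ^~ a) a \in F n.+1.
Proof. by move=> a1; elim: n => //= n IHn; exact: dfil_succ1r. Qed.

Lemma dEprec_fil a : a \in F 1 -> dEprec a \in F 1.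
Proof.
move=> a1; apply: dsum_fil => n; have af := iter_prec_fil n a1.
  exact: dfilS.
exact: dfil_le af.
Qed.

Lemma dEsucc_fil a : a \in F 1 -> dEsucc a \in F 1.
Proof.
move=> a1; apply: dsum_fil => n; have af := iter_succ_fil n a1.
  exact: dfilS.
exact: dfil_le af.
Qed.

Lemma dEprecE a : a \in F 1 -> dEprec a = a + a <~ dEprec a.
Proof.
move=> a1; rewrite {1}/dEprec dsum_recl => [|n]; last exact/dfilS/iter_prec_fil.
by rewrite [X in _ = _ + X]dsum_linear // => n *; apply: dfilS;
  [exact: dfil_prec1l|exact: iter_prec_fil].
Qed.

Lemma dEsuccE a : a \in F 1 -> dEsucc a = a + dEsucc a ~> a.
Proof.
move=> a1; rewrite {1}/dEsucc dsum_recl => [|n]; last exact/dfilS/iter_succ_fil.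
by rewrite -[X in _ = _ + X]/(applyr (dsucc S) a _) dsum_linear // => n *;
  apply: dfilS; [exact: dfil_succ1r|exact: iter_succ_fil].
Qed.

Lemma dEprec_unique a f : a \in F 1 -> f = a + a <~ f -> f = dEprec a.
Proof.
move=> a1 fE; apply/eqP; rewrite -subr_eq0; apply/eqP.
apply: (@dfil_contract _ _ S (dprec S a)) => [n g|]; first exact: dfil_prec1l.
by rewrite {1}fE {1}(dEprecE a1) opprD addrACA subrr add0r raddfB.
Qed.

Lemma ract_inj v f : f \in F 1 -> v + v <~ f = 0 -> v = 0.
Proof.
move=> f1 /eqP; rewrite addr_eq0 => /eqP vE.
apply: (@dfil_contract _ _ S (applyr (dprec S) (- f))) => [n g gF|].
  by apply: dfil_prec1r; rewrite ?rpredN.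
by rewrite {1}vE -linearNr.
Qed.

(** Read [v + v <~ f] as [v] acted upon by [1 + f] from the right. The axiom [dprecA] says precisely
    that this is a right action of the multiplicative monoid of the elements [1 + f]. *)
Lemma ractA v f g : f \in F 1 -> g \in F 1 ->
  v + v <~ f + (v + v <~ f) <~ g = v + v <~ (f + g + f * g).
Proof.
move=> f1 g1; rewrite (dmulE f1 g1) linearDl dprecA !linearDr /=.
by rewrite -!addrA; congr (_ + _); congr (_ + _).
Qed.

Lemma dmul1D f g : (1 + f) * (1 + g) = 1 + (f + g + f * g).
Proof. by rewrite mulrDl !mulrDr !mul1r mulr1 -!addrA [g + _]addrCA. Qed.

(** Insert the fixed point equation of [g] into [g <~ f] and that of [f] into [g ~> f]. By
    [dsuccprecA], [g ~> (a <~ f)] occurs with both signs, and what remains cancels against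
    [f + g]. *)
Lemma dEsuccN_Eprec a : a \in F 1 -> (1 + dEsucc (- a)) * (1 + dEprec a) = 1.
Proof.
move=> a1; have Na1 : - a \in F 1 by rewrite rpredN.
have [f1 g1] := (dEprec_fil a1, dEsucc_fil Na1).
rewrite dmul1D (dmulE g1 f1).
have gE := dEsuccE Na1; have fE := dEprecE a1.
set f := dEprec a in f1 fE *; set g := dEsucc (- a) in g1 gE *.
have -> : g <~ f = - (a <~ f) - g ~> (a <~ f).
  by rewrite {1}gE linearDl linearNl linearNr linearNl dsuccprecA.
have -> : g ~> f = g ~> a + g ~> (a <~ f) by rewrite {1}fE linearDr.
rewrite {1}gE {1}fE linearNr /=.
rewrite [X in 1 + X](_ : _ = 0) ?addr0 //.
set x := a <~ f; set y := g ~> a; set z := g ~> x.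
rewrite [X in X + _]addrACA addNr add0r [X in _ + X]addrACA addNr addr0.
by rewrite addrA addrK addNr.
Qed.

(** The product [1 + d] in the other order is idempotent, whence [d = - d * d]; multiplication by
    [- d] raises the filtration degree, so [d] is zero. *)
Lemma linv_rinv f g : f \in F 1 -> g \in F 1 ->
  (1 + g) * (1 + f) = 1 -> (1 + f) * (1 + g) = 1.
Proof.
move=> f1 g1 gf1; set d := f + g + f * g.
have dF : d \in F 1.
  by rewrite !rpredD //; apply: (@dfil_le _ _ _ _ 2) => //; exact: (@dfilM _ _ S 1 1).
suff d0 : d = 0 by rewrite dmul1D -/d d0 addr0.
have idem : (1 + d) * (1 + d) = 1 + d.
  by rewrite -dmul1D mulrA -[_ * _ * (1 + f)]mulrA gf1 mulr1.
apply: (@dfil_contract _ _ S ( *%R (- d))) => [n h hF|].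
  by rewrite -add1n; apply: dfilM; rewrite ?rpredN.
move/addrI/eqP: (etrans (esym (dmul1D d d)) idem).
by rewrite -addrA -[X in _ == X]addr0 => /eqP/addrI/eqP; rewrite addr_eq0 mulNr => /eqP.
Qed.

Definition dL b f := b ~> f - f <~ b.

HB.instance Definition _ b :=
  GRing.Linear.copy (dL b) (dsucc S b \- applyr (dprec S) b).

Definition dW b := dsum (fun n => (n.+1`!%:R : k)^-1 *: iter n (dL b) b).
Definition dexp b := dsum (fun n => (n.+1`!%:R : k)^-1 *: b ^+ n.+1).

Lemma dL_fil b n f : b \in F 1 -> f \in F n -> dL b f \in F n.+1.
Proof. by move=> b1 fn; rewrite rpredB //; [exact: dfil_succ1l|exact: dfil_prec1r]. Qed.

Lemma iter_dL_fil b m n f : b \in F 1 -> f \in F n -> iter m (dL b) f \in F (m + n).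
Proof. by move=> b1 fn; elim: m => //= m; exact: dL_fil. Qed.

Lemma iter_prec_expr b f n : b \in F 1 ->
  iter n.+1 (dprec S ^~ b) f = f <~ b ^+ n.+1.
Proof.
move=> b1; elim: n f => // n IHn f.
rewrite iterSr IHn dprecA [b ^+ n.+2]exprS.
by rewrite (dmulE b1) //; exact: dfil1XS.
Qed.

(** Left and right multiplications by [b] commute because of [dsuccprecA]. *)
Lemma dL_iter_prec b n f :
  dL b (iter n (dprec S ^~ b) f) = iter n (dprec S ^~ b) (dL b f).
Proof.
elim: n => //= n <-.
by rewrite /dL linearBl dsuccprecA.
Qed.

(** The left and right multiplications by [b] commute, and [dL b] is their
  difference: this is the binomial theorem with its last term removed. *)
Lemma expr_dL b m : b \in F 1 ->
  b ^+ m.+1 = \sum_(i < m.+1)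
    'C(m.+1, i)%:R *: iter i (dprec S ^~ b) (iter (m - i) (dL b) b).
Proof.
move=> b1; elim: m => [|m IHm]; first by rewrite big_ord1 scale1r.
(* The half [b <~ b ^+ m.+1] becomes [t m.+1 0]. It supplies the last term, of coefficient 1, that
   the expansion of [dL b (b ^+ m.+1)] lacks for Pascal's rule to apply. *)
rewrite exprS (dmulE b1 (dfil1XS m b1)) -iter_prec_expr //.
pose t i j := iter i (dprec S ^~ b) (iter j (dL b) b).
have Lt : b ~> b ^+ m.+1 = dL b (b ^+ m.+1) + applyr (dprec S) b (b ^+ m.+1).
  by rewrite subrK.
rewrite Lt.
have -> : dL b (b ^+ m.+1) = \sum_(i < m.+1) 'C(m.+1, i)%:R *: t i (m.+1 - i)%N.
  rewrite IHm linear_sum; apply: eq_bigr => i _.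
  by rewrite linearZZ /= dL_iter_prec -iterS -subSn // -ltnS.
have -> : applyr (dprec S) b (b ^+ m.+1) =
    \sum_(i < m.+1) 'C(m.+1, i)%:R *: t i.+1 (m - i)%N.
  by rewrite IHm linear_sum; apply: eq_bigr => i _; rewrite linearZZ.
rewrite [RHS]big_ord_recl.
under [X in _ = _ + X]eq_bigr => i _ do rewrite binS natrD scalerDl.
rewrite big_split [RHS]addrA [LHS]addrA; congr (_ + _) => /=.
transitivity (\sum_(i < m.+2) 'C(m.+1, i)%:R *: t i (m.+1 - i)%N).
  by rewrite addrC [RHS]big_ord_recr /= subnn binn scale1r.
by rewrite big_ord_recl !bin0.
Qed.

Hypothesis k0 : [pchar k] =i pred0.

Lemma bin_div_fact m i : (i <= m)%N ->
  (m`!%:R : k)^-1 * 'C(m, i)%:R = (m - i)`!%:R^-1 * i`!%:R^-1.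
Proof.
move=> im; rewrite -(bin_fact im) !natrM invfM mulrAC mulVf; first by rewrite mul1r invfM mulrC.
by rewrite ((pcharf0P k).1 k0) -lt0n bin_gt0.
Qed.

Lemma dexp_fil b n : b \in F 1 -> (n.+1`!%:R : k)^-1 *: b ^+ n.+1 \in F n.+1.
Proof. by move=> b1; rewrite rpredZ // dfil1X. Qed.

Lemma dW_fil b n : b \in F 1 ->
  (n.+1`!%:R : k)^-1 *: iter n (dL b) b \in F n.+1.
Proof. by move=> b1; rewrite rpredZ // -addn1 iter_dL_fil. Qed.

Fact iter_prec_linear b n :
  linear (fun f => (n`!%:R : k)^-1 *: iter n (dprec S ^~ b) f).
Proof.
move=> c f g; rewrite scalerA mulrC -scalerA -scalerDr; congr (_ *: _).
by elim: n f g => // n IHn f g; rewrite !iterSr -IHn linearPl.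
Qed.

(** Divided by (m+1)!, [expr_dL] is the Cauchy product of the operators r^i / i!, with r =
    [dprec S ^~ b], and of the terms of [dW b]. The operators of positive index sum to the right
    product by [dexp b], and the one of index 0 is the identity. *)
Lemma dexpE b : b \in F 1 -> dexp b = dW b + dW b <~ dexp b.
Proof.
move=> b1.
have eF n := dexp_fil n b1; have wF n := dW_fil n b1.
pose phi n := HB.pack_for {linear U -> U}
  (fun f => (n`!%:R : k)^-1 *: iter n (dprec S ^~ b) f)
  (GRing.isLinear.Build k U U *:%R _ (iter_prec_linear b n)).
have phiF m n f : f \in F n -> phi m f \in F (m + n).
  move=> fF; rewrite rpredZ //.
  by elim: m => //= m; rewrite addSn => /dfil_prec1r; exact.
have -> : dW b + dW b <~ dexp b = dsum (fun n => phi n (dW b)).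
  rewrite dsum_recl => [|n]; last first.
    by have := phiF n 0%N _ (dfil0 S (dW b)); rewrite addn0.
  congr (_ + _); first by rewrite /= invr1 scale1r.
  rewrite dsum_linear => [|n g|n]; last exact: dfilS.
    by congr dsum; apply/funext => n; rewrite linearZZ /phi /= -iter_prec_expr.
  by move=> gF; apply: dfilS; apply: dfil_prec1l => //; apply: dsum_fil => m;
    [exact: dfilS|exact: dfil_le (wF m)].
rewrite dsum_dsum // => [|n]; last exact: dfilS.
congr dsum; apply/funext => n; rewrite expr_dL // scaler_sumr.
apply: eq_bigr => i _.
rewrite [RHS]linearZZ /phi /= !scalerA; congr (_ *: _).
by rewrite bin_div_fact ?(ltnW (ltn_ord i)) // -subSn // -ltnS.
Qed.

(** The hypothesis says that the formal power series with coefficients [c] and [d] are inverse to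
    each other; substituting [dL b] for the variable gives inverse operators. *)
Lemma dsum_iter_dL (c d : nat -> k) b v : b \in F 1 ->
  (forall n, \sum_(i < n.+1) c i * d (n - i)%N = (n == 0%N)%:R) ->
  dsum (fun n => c n *: iter n (dL b) (dsum (fun n => d n *: iter n (dL b) v)))
  = v.
Proof.
move=> b1 cd.
have LF m n f : f \in F n -> iter m (dL b) f \in F (m + n) by exact: iter_dL_fil.
have LF0 m f : iter m (dL b) f \in F m.
  by have := LF m 0%N f (dfil0 S f); rewrite addn0.
have L_lin n : linear (fun f => c n *: iter n (dL b) f).
  move=> a f g; rewrite scalerA mulrC -scalerA -scalerDr; congr (_ *: _).
  by elim: n f g => // n IHn f g; rewrite !iterSr -IHn linearP.
pose phi n := HB.pack_for {linear U -> U} (fun f => c n *: iter n (dL b) f)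
  (GRing.isLinear.Build k U U *:%R _ (L_lin n)).
rewrite -[X in X = _]/(dsum (fun n => phi n _)).
rewrite dsum_dsum => [|m n f fF|n]; last 2 first.
- by rewrite rpredZ ?LF.
- by rewrite rpredZ.
have E n : \sum_(i < n.+1) phi i (d (n - i)%N *: iter (n - i)%N (dL b) v) =
    (n == 0%N)%:R *: iter n (dL b) v.
  rewrite -cd scaler_suml; apply: eq_bigr => i _.
  rewrite [LHS]linearZZ /phi /= scalerA mulrC -iterD subnKC // -ltnS //.
under [X in dsum X]funext do rewrite E.
apply: dsum_unique => [n|[|n]]; rewrite ?dfil0 //.
  by rewrite rpredZ.
rewrite big_ord_recl big1 ?addr0 => [|i _]; last by rewrite scale0r.
by rewrite scale1r subrr rpred0.
Qed.

(** The series are (e^t - 1) / t and t / (e^t - 1). *)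
Lemma inv_fact_bernoulli n :
  \sum_(i < n.+1) (i.+1`!%:R)^-1 * (bernoulli k (n - i) / (n - i)`!%:R) =
  (n == 0%N)%:R.
Proof.
rewrite -[RHS]mul1r.
(* The factor is 1 at n = 0 and multiplies 0 elsewhere; with it the goal is [bernoulliP] divided by
   (n+1)!. *)
have -> : 1 * (n == 0%N)%:R = (n.+1`!%:R)^-1 * (n == 0%N)%:R :> k.
  by case: n => [|n]; rewrite ?mulr0 // invr1.
rewrite -(bernoulliP k0) mulr_sumr [RHS](reindex_inj rev_ord_inj) /=.
apply: eq_bigr => i _; rewrite subSS [RHS]mulrA bin_div_fact ?leqW ?leq_subr //.
by rewrite subSn ?leq_subr // subKn -1?ltnS // mulrAC mulrA.
Qed.

Lemma bernoulli_inv_fact n :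
  \sum_(i < n.+1) (bernoulli k i / i`!%:R) * ((n - i).+1`!%:R)^-1 =
  (n == 0%N)%:R.
Proof.
rewrite -inv_fact_bernoulli [RHS](reindex_inj rev_ord_inj) /=.
by apply: eq_bigr => i _; rewrite subSS subKn -1?ltnS // mulrC.
Qed.

(** With t = [dL b], the equation reads b = t / (e^t - 1) applied to [a], while [dW b] is (e^t - 1)
    / t applied to [b]. *)
Lemma dW_Omega a b : b \in F 1 ->
  b = dsum (fun m => (bernoulli k m / m`!%:R) *: iter m (dL b) a) -> dW b = a.
Proof.
move=> b1 bE.
rewrite -[RHS](@dsum_iter_dL (fun n => (n.+1`!%:R)^-1)
  (fun n => bernoulli k n / n`!%:R) b a b1 inv_fact_bernoulli).
by rewrite -bE.
Qed.

Lemma Omega_dW b : b \in F 1 ->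
  b = dsum (fun m => (bernoulli k m / m`!%:R) *: iter m (dL b) (dW b)).
Proof.
move=> b1; exact/esym/(@dsum_iter_dL (fun n => bernoulli k n / n`!%:R)
  (fun n => (n.+1`!%:R)^-1) b b b1 bernoulli_inv_fact).
Qed.

End Exponentials.

(** * Truncated exponential of the truncated logarithm of 1 + X, as polynomials *)

Section ExpLogPoly.
Variables (k : fieldType).
Hypothesis k0 : [pchar k] =i pred0.

Definition log_poly n : {poly k} :=
  \sum_(i < n) ((-1) ^+ i / i.+1%:R) *: 'X^(i.+1).

Definition exp_log_poly n : {poly k} :=
  \sum_(i < n.+1) (i`!%:R)^-1 *: log_poly n ^+ i.

Lemma deriv_log_poly n : (1 + 'X) * (log_poly n)^`() = 1 - (- 'X) ^+ n.
Proof.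
have -> : (log_poly n)^`() = \sum_(i < n) (- 'X) ^+ i.
  rewrite /log_poly linear_sum; apply: eq_bigr => i _.
  rewrite linearZ /= derivXn /= -scaler_nat scalerA divfK; last first.
    by rewrite ((pcharf0P k).1 k0).
  by rewrite [RHS]exprNn -mul_polyC rmorph_sign.
by apply: oppr_inj; rewrite opprB subrX1 -mulNr opprD addrC.
Qed.

Lemma log_polyX n : exists K, log_poly n = 'X * K.
Proof.
exists (\sum_(i < n) ((-1) ^+ i / i.+1%:R) *: 'X^i).
by rewrite mulr_sumr; apply: eq_bigr => i _; rewrite -scalerAr exprS.
Qed.

Lemma deriv_exp_log_poly n :
  (exp_log_poly n)^`() =
  (log_poly n)^`() * (exp_log_poly n - (n`!%:R)^-1 *: log_poly n ^+ n).
Proof.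
rewrite /exp_log_poly [in RHS]big_ord_recr /= addrK linear_sum big_ord_recl /=.
rewrite expr0 derivZ derivC scaler0 add0r mulr_sumr; apply: eq_bigr => i _.
rewrite derivZ deriv_exp -scaler_nat /= scalerA -scalerAr; congr (_ *: _).
rewrite factS natrM invfM mulrAC mulVf ?mul1r //.
by rewrite ((pcharf0P k).1 k0).
Qed.

(** The coefficients of [C] up to degree [n] are those of a solution of the
  differential equation [(1 + X) C' = C]. *)
Lemma exp_log_poly_coef n i : (i < n)%N ->
  (exp_log_poly n)`_i.+1 *+ i.+1 + (exp_log_poly n)`_i *+ i = (exp_log_poly n)`_i.
Proof.
move=> lin; have [K LE] := log_polyX n; set C := exp_log_poly n.
(* Two truncation errors are multiples of X^n: the end of the geometric sum in [deriv_log_poly], and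
   the top exponential term lost by derivation, which is [log_poly n ^+ n] = X^n K^n up to a
   scalar. *)
pose Q := - (n`!%:R)^-1 *: K ^+ n -
  (-1) ^+ n * (C - (n`!%:R)^-1 *: log_poly n ^+ n).
have : (1 + 'X) * C^`() = C + 'X^n * Q.
  rewrite deriv_exp_log_poly mulrA deriv_log_poly /Q -/C LE exprMn (exprNn 'X).
  rewrite scaleNr !scalerAr -!mul_polyC.
  move: (_%:P) ('X^n) (K ^+ n) ((-1) ^+ n) => c x y e; ring.
move/(congr1 (fun p : {poly k} => p`_i)).
rewrite /= mulrDl mul1r !coefD coefXM !coef_deriv coefXnM lin addr0.
by case: i {lin} => [|i] //=; rewrite mulr0n.
Qed.

(** The differential equation gives (i+1) C_(i+1) = (1 - i) C_i for i < n. Starting from C_0 = 1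
    this yields C_1 = 1 and then C_2 = 0, after which all coefficients in range vanish in
    characteristic zero. *)
Lemma exp_log_polyE n : exists R, exp_log_poly n = 1 + 'X + 'X^n * R.
Proof.
set C := exp_log_poly n.
have C0 : C`_0 = 1.
  have [K LE] := log_polyX n.
  rewrite /C /exp_log_poly big_ord_recl coefD coefZ fact0 invr1 mul1r expr0 coef1.
  rewrite coef_sum big1 ?addr0 // => i _.
  by rewrite coefZ LE exprS -mulrA coefXM mulr0.
have mulSn_eq0 i (c : k) : c *+ i.+1 = 0 -> c = 0.
  move=> /eqP; rewrite -mulr_natr mulf_eq0 ((pcharf0P k).1 k0) orbF.
  by move/eqP.
have C2 i : (i.+1 < n)%N -> C`_i.+2 = 0.
  elim: i => [|i IHi] lin; [apply: (mulSn_eq0 1%N)|apply: (mulSn_eq0 i.+2)].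
    by have /(canRL (addrK _)) := exp_log_poly_coef lin; rewrite mulr1n subrr.
  have := exp_log_poly_coef lin; rewrite -/C (IHi (ltnW lin)).
  by rewrite mul0rn addr0.
exists (drop_poly n (C - (1 + 'X))).
rewrite -{1}[C](subrKC (1 + 'X)); congr (_ + _).
rewrite mulrC -[LHS](poly_take_drop n) [X in X + _](_ : _ = 0) ?add0r //.
apply/polyP => i; rewrite coef_take_poly coef0; case: ifP => // lin.
rewrite coefB coefD coef1 coefX.
case: i lin => [|[|i]] lin /=; first by rewrite addr0 C0 subrr.
  by have := exp_log_poly_coef (ltnW lin); rewrite -/C C0 mulr0n addr0 mulr1n => ->;
    rewrite add0r subrr.
by rewrite C2 ?addr0 ?subrr // ltnW.
Qed.

End ExpLogPoly.

(** * The logarithm as a right inverse of the exponential *)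

Section Logarithm.
Variables (k : fieldType) (U : algType k) (S : dendriform U).
Implicit Types (a b f g h v : U).
Local Notation F := (dfil S).
Local Notation dsum := (dsum S).
Hypothesis k0 : [pchar k] =i pred0.

Definition dlog f := - dsum (fun n => ((-1) ^+ n.+1 / n.+1%:R : k) *: f ^+ n.+1).

Lemma dlog_fil_term f n : f \in F 1 ->
  ((-1) ^+ n.+1 / n.+1%:R : k) *: f ^+ n.+1 \in F n.+1.
Proof. by move=> f1; rewrite rpredZ // dfil1X. Qed.

Lemma dlog_fil f : f \in F 1 -> dlog f \in F 1.
Proof.
move=> f1; rewrite rpredN; apply: dsum_fil => n; first exact/dfilS/dlog_fil_term.
exact: dfil_le (dlog_fil_term n f1).
Qed.

Lemma dfilB_expr n b c m : b - c \in F n -> b ^+ m - c ^+ m \in F n.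
Proof.
move=> bc; elim: m => [|m IHm]; first by rewrite subrr rpred0.
rewrite !exprS -[_ - _](subrKA (b * c ^+ m)) -mulrBr -mulrBl rpredD //.
  exact: (@dfilM _ _ S 0 n _ _ (dfil0 S b)).
by rewrite -[n]addn0; apply: dfilM => //; exact: dfil0.
Qed.

(** Modulo [F n], both series may be truncated, and the identity becomes the value at [f] of the
    polynomial identity [exp_log_polyE], whose remainder X^n R evaluates into [F n]. *)
Lemma dlogK f : f \in F 1 -> dexp S (dlog f) = f.
Proof.
move=> f1; have b1 := dlog_fil f1; set b := dlog f in b1 *.
pose c n : U := horner_alg f (log_poly k n).
have cE n : c n = \sum_(i < n) ((-1) ^+ i / i.+1%:R : k) *: f ^+ i.+1.
  rewrite /c linear_sum; apply: eq_bigr => i _.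
  by rewrite linearZ /= rmorphXn /= horner_algX mulr_algl.
have bc n : b - c n \in F n.
  rewrite -opprB rpredN cE /b opprK.
  have := dsumP (fun n => dfilS (dlog_fil_term n f1)) n; congr (_ \in F n).
  rewrite addrC; congr (_ + _); rewrite -sumrN; apply: eq_bigr => i _.
  by rewrite exprS mulN1r mulNr scaleNr opprK.
have eE n : \sum_(i < n) (i.+1`!%:R : k)^-1 *: c n ^+ i.+1 - f \in F n.
  have [R RE] := exp_log_polyE k0 n.
  have := congr1 (horner_alg f) RE.
  rewrite !rmorphD rmorph1 rmorphM rmorphXn /= horner_algX linear_sum /=.
  rewrite big_ord_recl linearZ /= mulr_algl expr0 invr1 scale1r rmorph1 -addrA => /addrI.
  under eq_bigr => i _ do rewrite linearZ /= mulr_algl rmorphXn /= -/(c n).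
  move=> ->; rewrite addrAC subrr add0r.
  by have := dfilM (dfil1X n f1) (dfil0 S (horner_alg f R)); rewrite addn0.
apply/eqP; rewrite -subr_eq0; apply/eqP/(@dfil_sep _ _ S) => n.
have := dsumP (fun n => dfilS (dexp_fil n b1)) n.
rewrite -[dexp S b - f](subrKA (\sum_(i < n) (i.+1`!%:R : k)^-1 *: b ^+ i.+1)).
move=> /rpredD; apply.
rewrite -[_ - _](subrKA (\sum_(i < n) (i.+1`!%:R : k)^-1 *: c n ^+ i.+1)).
rewrite rpredD // -sumrB rpred_sum // => i _.
by rewrite -scalerBr rpredZ // dfilB_expr.
Qed.

End Logarithm.

(** * The Magnus expansion and the half-product logarithm *)

Section PreLieMagnusExpansion.
Variables (k : fieldType) (U : algType k) (S : dendriform U).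
Implicit Types (a b f g h v : U).
Local Notation F := (dfil S).
Local Notation "f '<~' g" := (dprec S f g) (at level 45, left associativity).
Hypothesis k0 : [pchar k] =i pred0.

Definition is_Omega a b :=
  b = dsum S (fun m => (bernoulli k m / m`!%:R) *: iter m (dL S b) a).

Lemma dexp_Omega a b : a \in F 1 -> b \in F 1 -> is_Omega a b ->
  dexp S b = dEprec S a.
Proof.
move=> a1 b1 ab; apply: dEprec_unique => //.
by rewrite {1}(dexpE k0 b1) (dW_Omega k0 b1 ab).
Qed.

(** Write P = [dEprec S a] = [dexp S b]. It equals both [a + a <~ P] and [dW S b + dW S b <~ P], so
    [1 + P] acts on [dW S b - a] as zero and [ract_inj] gives [dW S b = a]. *)
Lemma is_Omega_dlog a : a \in F 1 -> is_Omega a (dlog S (dEprec S a)).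
Proof.
move=> a1; have P1 := dEprec_fil a1; have b1 := dlog_fil P1.
rewrite /is_Omega; set b := dlog S _ in b1 *.
suff Wb : dW S b = a by rewrite {1}(Omega_dW k0 b1) Wb.
apply/eqP; rewrite -subr_eq0; apply/eqP/(ract_inj P1).
have := dexpE k0 b1; rewrite dlogK // {1}dEprecE //.
by rewrite linearBl addrACA -opprD => <-; rewrite subrr.
Qed.

(** By [dexpE], [f] is [dW S (dlog S f)] acted upon by [1 + f]; acting further by the inverse
    [1 + g] recovers [dW S (dlog S f)]. *)
Lemma log_prec_dW f g : f \in F 1 -> g \in F 1 -> (1 + f) * (1 + g) = 1 ->
  f + f <~ g = dW S (dlog S f).
Proof.
move=> f1 g1 fg1; have b1 := dlog_fil f1.
have fE := dexpE k0 b1; rewrite dlogK // in fE.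
rewrite {1 2}fE ractA // [X in _ <~ X](_ : _ = 0) ?linear0r ?addr0 //.
by apply: (addrI 1); rewrite -dmul1D fg1 addr0.
Qed.

End PreLieMagnusExpansion.

(** * The convolution algebra of an unshuffle bialgebra *)

Section TensorMaps.
Variables (k : fieldType).

Lemma tens_ext (V W U : lmodType k) (h1 h2 : {linear tens V W -> U}) :
  (forall v w, h1 (v \ox w) = h2 (v \ox w)) -> h1 =1 h2.
Proof.
move=> h12; elim/tens_ind=> s.
by rewrite tens_class_sum !linear_sum; apply: eq_bigr => p _; exact: h12.
Qed.

Section Tmap.
Variables (V W V' W' : lmodType k) (f : {linear V -> V'}) (g : {linear W -> W'}).

Fact tmap_linl w : linear (fun v => f v \ox g w).
Proof. by move=> a v v'; rewrite linearP pure_tens_linearl. Qed.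

Fact tmap_linr v : linear (fun w => f v \ox g w).
Proof. by move=> a w w'; rewrite linearP pure_tens_linearr. Qed.

HB.instance Definition _ := GRing.isLinear.Build k (tens V W) (tens V' W') *:%R
  (tmap f g) (tlift_linear tmap_linl tmap_linr).

Lemma tmap_pure v w : tmap f g (v \ox w) = f v \ox g w.
Proof. exact: (tlift_pure tmap_linl tmap_linr). Qed.

End Tmap.

Section MulA.
Variable A : comAlgType k.

Fact mulA_linl (w : A) : linear (fun v : A => v * w).
Proof. by move=> a v v'; rewrite mulrDl scalerAl. Qed.

Fact mulA_linr (v : A) : linear (fun w : A => v * w).
Proof. by move=> a w w'; rewrite mulrDr scalerAr. Qed.

HB.instance Definition _ := GRing.isLinear.Build k _ _ *:%R
  (@Defs.mulA k A) (tlift_linear mulA_linl mulA_linr).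

Lemma mulA_pure (v w : A) : Defs.mulA (v \ox w) = v * w.
Proof. exact: (tlift_pure mulA_linl mulA_linr). Qed.

End MulA.

Section Tassoc.
Variables (U V W : lmodType k).

Fact tassoc_inl (w : W) (v : V) : linear (fun u : U => u \ox (v \ox w)).
Proof. exact: pure_tens_linearl. Qed.

Fact tassoc_inr (w : W) (u : U) : linear (fun v : V => u \ox (v \ox w)).
Proof. by move=> a v v'; rewrite pure_tens_linearl pure_tens_linearr. Qed.

Fact tassoc_linl (w : W) :
  linear (tlift (fun (u : U) (v : V) => u \ox (v \ox w))).
Proof. exact: tlift_linear (tassoc_inl w) (tassoc_inr w). Qed.

Fact tassoc_linr (t : tens U V) :
  linear (fun w : W => tlift (fun (u : U) (v : V) => u \ox (v \ox w)) t).
Proof.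
move=> a w w'; elim/tens_ind: t => s.
rewrite !(tlift_class (tassoc_inl _) (tassoc_inr _)) scaler_sumr -big_split.
by apply: eq_bigr => p _; rewrite /= pure_tens_linearr pure_tens_linearr.
Qed.

HB.instance Definition _ :=
  GRing.isLinear.Build k (tens (tens U V) W) (tens U (tens V W)) *:%R
  (@tassoc k U V W) (tlift_linear tassoc_linl tassoc_linr).

Lemma tassoc_pure (u : U) (v : V) (w : W) : tassoc ((u \ox v) \ox w) = u \ox (v \ox w).
Proof.
rewrite /tassoc (tlift_pure tassoc_linl tassoc_linr).
exact: (tlift_pure (tassoc_inl w) (tassoc_inr w)).
Qed.

End Tassoc.

Section Convolve.
Variables (B : lmodType k) (A : comAlgType k).
Implicit Types (f g h : {linear B -> A}) (D : {linear B -> tens B B}).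

Definition convolve D (f g : B -> A) : B -> A := fun x => Defs.mulA (tmap f g (D x)).

HB.instance Definition _ D f g :=
  GRing.Linear.copy (convolve D f g) (@Defs.mulA k A \o tmap f g \o D).

Lemma mulA_tmap_pure f g v w : Defs.mulA (tmap f g (v \ox w)) = f v * g w.
Proof. by rewrite tmap_pure mulA_pure. Qed.

(** Both sides evaluate the triple product of [f], [g], [h] on the two tensors of the hypothesis.
    The hypothesis is taken at the single point [x] because the half-coproduct identities are
    available only on the kernel of the counit. *)
Lemma convolveA D1 D2 D3 D4 f g h x :
  tassoc (tmap D1 idfun (D2 x)) = tmap idfun D3 (D4 x) ->
  convolve D2 (convolve D1 f g) h x = convolve D4 f (convolve D3 g h) x.
Proof.
move=> DA; pose ev := @Defs.mulA k A \o tmap f (@Defs.mulA k A \o tmap g h).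
have evl t : ev (tassoc (tmap D1 idfun t)) = Defs.mulA (tmap (convolve D1 f g) h t).
  apply: (@tens_ext _ _ _ (ev \o @tassoc k B B B \o tmap D1 idfun)
    (@Defs.mulA k A \o tmap (convolve D1 f g) h)) => v w /=.
  rewrite !tmap_pure mulA_pure /convolve.
  (* For fixed [w] both sides are linear in the tensor [D1 v], so [tens_ext] applies a second
     time. *)
  have pl : linear (fun s : tens B B => s \ox w) by exact: pure_tens_linearl.
  pose pw := HB.pack_for {linear tens B B -> tens (tens B B) B}
    (fun s : tens B B => s \ox w) (GRing.isLinear.Build k _ _ *:%R _ pl).
  apply: (@tens_ext _ _ _ (ev \o @tassoc k B B B \o pw)
    (h w \o* (@Defs.mulA k A \o tmap f g))) => u v' /=.
  by rewrite tassoc_pure !tmap_pure !mulA_pure /= mulA_tmap_pure mulrA.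
have evr t : ev (tmap idfun D3 t) = Defs.mulA (tmap f (convolve D3 g h) t).
  apply: (@tens_ext _ _ _ (ev \o tmap idfun D3)
    (@Defs.mulA k A \o tmap f (convolve D3 g h))) => v w /=.
  by rewrite !tmap_pure !mulA_pure.
by rewrite /convolve -evl DA evr.
Qed.

Fact convolve_linl D g (x : B) a (f f' : {linear B -> A}) :
  convolve D (a *: (f : B -> A) + (f' : B -> A)) g x =
  a *: convolve D f g x + convolve D f' g x.
Proof.
have ff : linear (a *: (f : B -> A) + (f' : B -> A)).
  move=> c y z; rewrite -[LHS]/(a *: f (c *: y + z) + f' (c *: y + z)).
  by rewrite (linearP f) (linearP f') !scalerDr !scalerA mulrC addrACA.
pose F := HB.pack_for {linear B -> A} (a *: (f : B -> A) + (f' : B -> A))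
  (GRing.isLinear.Build k _ _ *:%R _ ff).
apply: (@tens_ext _ _ _ (@Defs.mulA k A \o tmap F g)
  (a \*: (@Defs.mulA k A \o tmap f g) \+ (@Defs.mulA k A \o tmap f' g))) => v w /=.
by rewrite !mulA_tmap_pure /= -[LHS]/((a *: f v + f' v) * g w) mulrDl scalerAl.
Qed.

Fact convolve_linr D f (x : B) a (g g' : {linear B -> A}) :
  convolve D f (a *: (g : B -> A) + (g' : B -> A)) x =
  a *: convolve D f g x + convolve D f g' x.
Proof.
have gg : linear (a *: (g : B -> A) + (g' : B -> A)).
  move=> c y z; rewrite -[LHS]/(a *: g (c *: y + z) + g' (c *: y + z)).
  by rewrite (linearP g) (linearP g') !scalerDr !scalerA mulrC addrACA.
pose G := HB.pack_for {linear B -> A} (a *: (g : B -> A) + (g' : B -> A))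
  (GRing.isLinear.Build k _ _ *:%R _ gg).
apply: (@tens_ext _ _ _ (@Defs.mulA k A \o tmap f G)
  (a \*: (@Defs.mulA k A \o tmap f g) \+ (@Defs.mulA k A \o tmap f g'))) => v w /=.
by rewrite !mulA_tmap_pure /= -[LHS]/(f v * (a *: g w + g' w)) mulrDr scalerAr.
Qed.

End Convolve.
End TensorMaps.

(** * The space of linear maps from B to A *)

Section LinMaps.
Variables (k : fieldType) (B : algType k) (A : comAlgType k).

Definition lin_pred : {pred B -> A} := fun f => `[< linear f >].

Fact lin_pred_closed : GRing.submod_closed lin_pred.
Proof.
split=> [|a f g /asboolP fl /asboolP gl]; apply/asboolP => c x y.
  by rewrite -[LHS]/(0 : A) -[RHS]/(c *: 0 + 0 : A) scaler0 addr0.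
rewrite -[LHS]/(a *: f (c *: x + y) + g (c *: x + y)).
by rewrite fl gl !scalerDr !scalerA mulrC addrACA.
Qed.

HB.instance Definition _ :=
  GRing.isSubmodClosed.Build k (B -> A) lin_pred lin_pred_closed.

(** [H] is a phantom parameter, on which the convolution product depends. *)
Record linmap (H : unshuffle_bialg B) :=
  Linmap { linval :> B -> A; _ : linval \in lin_pred }.

Variable H : unshuffle_bialg B.

HB.instance Definition _ := [isSub for @linval H].
HB.instance Definition _ := [Choice of linmap H by <:].
HB.instance Definition _ := [SubChoice_isSubZmodule of linmap H by <:].
HB.instance Definition _ := [SubZmodule_isSubLmodule of linmap H by <:].

Lemma linmap_linear (f : linmap H) : linear f.
Proof. by case: f => f /= /asboolP. Qed.

HB.instance Definition _ (f : linmap H) :=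
  GRing.isLinear.Build k B A *:%R (linval f) (linmap_linear f).

Definition mk_linmap (f : B -> A) (fl : linear f) : linmap H :=
  Linmap H (asboolT fl : f \in lin_pred).

Definition lconv D (f g : linmap H) : linmap H :=
  mk_linmap (@linearP _ _ _ _ (convolve D f g)).

Lemma linmapP (f g : linmap H) : (forall x, f x = g x) -> f = g.
Proof. by move=> fg; apply/val_inj/funext. Qed.

Fact lconv_bilinear D : bilinear_for *:%R *:%R (lconv D).
Proof.
split=> [g a f f'|f a g g']; apply: linmapP => x.
  exact: convolve_linl.
exact: convolve_linr.
Qed.

HB.instance Definition _ D := bilinear_isBilinear.Build k _ _ _ _ _ (lconv D)
  (lconv_bilinear D).

End LinMaps.

(** * Convolution algebra and its dendriform structure *)

Section ConvolutionAlgebra.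
Variables (k : fieldType) (B : algType k) (H : unshuffle_bialg B).
Variable A : comAlgType k.
Local Notation U := (linmap A H).
Implicit Types (f g h : U).

Lemma aug_linear : linear (aug H A).
Proof. by move=> a x y; rewrite /aug linearP scalerDl scalerA. Qed.

HB.instance Definition _ :=
  GRing.isLinear.Build k B A *:%R (aug H A) aug_linear.

Definition lone : U := mk_linmap H aug_linear.

Lemma aug1 : aug H A 1 = 1.
Proof. by rewrite /aug us_counit1 scale1r. Qed.

Lemma aug_counit0 c : us_counit H c = 0 -> aug H A c = 0.
Proof. by move=> c0; rewrite /aug c0 scale0r. Qed.

Lemma counit_sub x : us_counit H (x - (us_counit H x)%:A) = 0.
Proof. by rewrite linearB linearZ /= us_counit1 mulr1 subrr. Qed.

Lemma linmap_ext f g :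
  f 1 = g 1 -> (forall c, us_counit H c = 0 -> f c = g c) -> f = g.
Proof.
move=> fg1 fgc; apply: linmapP => x.
have := fgc _ (counit_sub x); rewrite !linearB !linearZZ /= fg1.
exact: addIr.
Qed.

Fact lconvA : associative (lconv (us_cop H) : U -> U -> U).
Proof.
move=> f g h; apply: linmapP => x; apply/esym/convolveA; exact: us_copA.
Qed.

Fact lconv1l : left_id lone (lconv (us_cop H)).
Proof.
move=> f; apply: linmapP => x.
have bl (w : B) : linear (fun v : B => us_counit H v *: w).
  by move=> a v v'; rewrite linearP scalerDl scalerA.
have br v : linear (fun w : B => us_counit H v *: w).
  by move=> a w w'; rewrite scalerDr !scalerA mulrC.
pose c := HB.pack_for {linear tens B B -> B} (tlift (fun v w => us_counit H v *: w))
  (GRing.isLinear.Build k _ _ *:%R _ (tlift_linear bl br)).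
rewrite -[in RHS](us_cop_counitl H x).
apply: (@tens_ext _ _ _ _ (@Defs.mulA k A \o tmap lone f) (f \o c)) => v w /=.
by rewrite mulA_tmap_pure tlift_pure // linearZZ mulr_algl.
Qed.

Fact lconv1r : right_id lone (lconv (us_cop H)).
Proof.
move=> f; apply: linmapP => x.
have bl (w : B) : linear (fun v : B => us_counit H w *: v).
  by move=> a v v'; rewrite scalerDr !scalerA mulrC.
have br (v : B) : linear (fun w : B => us_counit H w *: v).
  by move=> a w w'; rewrite linearP scalerDl scalerA.
pose c := HB.pack_for {linear tens B B -> B} (tlift (fun v w => us_counit H w *: v))
  (GRing.isLinear.Build k _ _ *:%R _ (tlift_linear bl br)).
rewrite -[in RHS](us_cop_counitr H x).
apply: (@tens_ext _ _ _ _ (@Defs.mulA k A \o tmap f lone) (f \o c)) => v w /=.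
by rewrite mulA_tmap_pure tlift_pure // linearZZ mulr_algr.
Qed.

Fact lone_neq0 : lone != 0.
Proof.
apply/eqP => /(congr1 (fun f : U => f 1)); rewrite /= aug1.
by apply/eqP; exact: oner_neq0.
Qed.

HB.instance Definition _ := GRing.Zmodule_isNzRing.Build U
  lconvA lconv1l lconv1r (fun f g h => linearDl _ h f g)
  (fun f => linearDr _ f) lone_neq0.

HB.instance Definition _ := GRing.Lmodule_isLalgebra.Build k U
  (fun a f g => esym (linearZl_LR _ g a f)).

HB.instance Definition _ := GRing.Lalgebra_isAlgebra.Build k U
  (fun a f g => esym (linearZr_LR _ f a g)).

Definition lfil n : {pred U} := fun f =>
  `[< forall i x, (i < n)%N -> x \in us_gr H i -> f x = 0 >].

Lemma lfilP n f :
  reflect (forall i x, (i < n)%N -> x \in us_gr H i -> f x = 0) (f \in lfil n).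
Proof. exact: asboolP. Qed.

Lemma lfil1P f : reflect (f 1 = 0) (f \in lfil 1).
Proof.
apply: (iffP (lfilP 1 f)) => [f0|f1 [|//] x _ /us_gr0P[a ->]].
  by apply: (f0 0%N) => //; apply/us_gr0P; exists 1; rewrite scale1r.
by rewrite linearZZ /= f1 scaler0.
Qed.

(** The bound depends on [x] alone. This makes the filtration separated and each series finite at
    [x]. *)
Lemma gr_bound x : exists N, forall f, f \in lfil N -> f x = 0.
Proof.
have [_ dec _] := us_grP H; have [N [y [yG ->]]] := dec x.
exists N => f /lfilP f0; rewrite linear_sum big1 // => i _.
exact: f0 (yG _).
Qed.

Lemma tspan_eq0 (V : lmodType k) (h : {linear tens B B -> V}) P t :
  tspan P t -> (forall v w, P v w -> h (v \ox w) = 0) -> h t = 0.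
Proof.
move=> [s sP ->] h0; rewrite linear_sum big_seq big1 // => p ps.
exact/h0/sP.
Qed.

(** Either i < m or j < n, so one of the two factors vanishes. *)
Lemma tmap_gr_eq0 m n i j f g v w : f \in lfil m -> g \in lfil n ->
  (i + j < m + n)%N -> v \in us_gr H i -> w \in us_gr H j ->
  Defs.mulA (tmap f g (v \ox w)) = 0.
Proof.
move=> /lfilP f0 /lfilP g0 ij vi wj; rewrite mulA_tmap_pure /=.
have [im|mi] := ltnP i m; first by rewrite (f0 i) ?mul0r.
have [jn|nj] := ltnP j n; first by rewrite (g0 j) ?mulr0.
by move: (leq_add mi nj); rewrite leqNgt ij.
Qed.

Fact lfil_closed n : GRing.submod_closed (lfil n).
Proof.
split=> [|a f g /lfilP f0 /lfilP g0]; apply/lfilP => // i x lin xi.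
by rewrite -[LHS]/(a *: f x + g x) (f0 i) ?(g0 i) // scaler0 addr0.
Qed.

Fact lfil0 f : f \in lfil 0.
Proof. exact/lfilP. Qed.

Fact lfilS n f : f \in lfil n.+1 -> f \in lfil n.
Proof. by move=> /lfilP f0; apply/lfilP => i x lin; apply/f0/ltnW. Qed.

Lemma lfil_le m n f : (m <= n)%N -> f \in lfil n -> f \in lfil m.
Proof.
by move=> mn /lfilP f0; apply/lfilP => i x im; apply: f0; exact: leq_trans mn.
Qed.

Fact lfil_sep f : (forall n, f \in lfil n) -> f = 0.
Proof.
move=> f0; apply: linmapP => x; have [N] := gr_bound x; exact.
Qed.

Fact lfilM m n f g : f \in lfil m -> g \in lfil n -> f * g \in lfil (m + n).
Proof.
move=> fm gn; apply/lfilP => l x lmn xl.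
apply: (tspan_eq0 (h := @Defs.mulA k A \o tmap f g) (us_cop_gr xl)).
by move=> v w [i [j [ij vi wj]]]; apply: tmap_gr_eq0 fm gn _ vi wj; rewrite ij.
Qed.

Fact lfil_prec m n f g : f \in lfil m -> g \in lfil n ->
  lconv (us_prec H) f g \in lfil (m + n).
Proof.
move=> fm gn; apply/lfilP => -[|l] x lmn xl.
  by have /us_gr0P[a ->] := xl; rewrite linearZZ /= /convolve us_prec1 !linear0.
apply: (tspan_eq0 (h := @Defs.mulA k A \o tmap f g) (us_prec_gr xl)).
by move=> v w [i [j [ij vi wj]]]; apply: tmap_gr_eq0 fm gn _ vi wj; rewrite ij.
Qed.

Fact lfil_succ m n f g : f \in lfil m -> g \in lfil n ->
  lconv (us_succ H) f g \in lfil (m + n).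
Proof.
move=> fm gn; apply/lfilP => -[|l] x lmn xl.
  by have /us_gr0P[a ->] := xl; rewrite linearZZ /= /convolve us_succ1 !linear0.
apply: (tspan_eq0 (h := @Defs.mulA k A \o tmap f g) (us_succ_gr xl)).
by move=> v w [i [j [ij vi wj]]]; apply: tmap_gr_eq0 fm gn _ vi wj; rewrite ij.
Qed.

Lemma lfsum_val (u : nat -> U) (N : nat) x :
  (forall n, u n \in lfil n) -> (forall f, f \in lfil N -> f x = 0) ->
  lfsum (fun n => u n : B -> A) x = \sum_(i < N) u i x.
Proof.
by move=> uF xN; apply: lfsumE => n Nn; apply: xN; exact: lfil_le (uF n).
Qed.

Lemma lfsum_linear (u : nat -> U) : (forall n, u n \in lfil n) ->
  linear (lfsum (fun n => u n : B -> A)).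
Proof.
move=> uF a x y; have [M xM] := gr_bound x; have [N yN] := gr_bound y.
have xMN f : f \in lfil (M + N) -> f x = 0.
  by move=> fF; apply/xM/(lfil_le (leq_addr _ _) fF).
have yMN f : f \in lfil (M + N) -> f y = 0.
  by move=> fF; apply/yN/(lfil_le (leq_addl _ _) fF).
rewrite !(@lfsum_val _ (M + N)) // => [|f fF].
  rewrite scaler_sumr -big_split; apply: eq_bigr => i _; exact: linearP.
by rewrite linearP /= xMN ?yMN // scaler0 addr0.
Qed.

(** For an arbitrary sequence the pointwise sum may fail to be linear; [insubd] then returns 0,
    which makes the sum a total function. *)
Definition lsum (u : nat -> U) : U :=
  insubd 0 (lfsum (fun n => u n : B -> A)).

Lemma lsumE (u : nat -> U) : (forall n, u n \in lfil n) ->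
  lsum u = lfsum (fun n => u n : B -> A) :> (B -> A).
Proof. by move=> uF; rewrite /lsum val_insubd ifT //; apply/asboolP/lfsum_linear. Qed.

Fact lsumP (u : nat -> U) : (forall n, u n \in lfil n) ->
  forall n, lsum u - \sum_(i < n) u i \in lfil n.
Proof.
move=> uF n; apply/lfilP => i x lin xi.
have sumE : (\sum_(i < n) u i : U) x = \sum_(i < n) u i x.
  exact: (big_morph (fun f : U => f x)).
rewrite -[LHS]/(lsum u x - (\sum_(i < n) u i : U) x) sumE lsumE //.
rewrite (@lfsum_val _ n) ?subrr // => f /lfilP f0; exact: f0 xi.
Qed.

HB.instance Definition _ :=
  GRing.Linear.copy (us_redcop H) (us_prec H \+ us_succ H).

Lemma lconv_redcop f g :
  lconv (us_prec H) f g + lconv (us_succ H) f g = lconv (us_redcop H) f g.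
Proof.
by apply: linmapP => x; rewrite /= /convolve /us_redcop !linearD.
Qed.

Lemma lconv_at1 (D : {linear B -> tens B B}) f g : D 1 = 0 -> lconv D f g 1 = 0.
Proof. by move=> D1; rewrite /= /convolve D1 !linear0. Qed.

Lemma redcop1 : us_redcop H 1 = 0.
Proof. by rewrite /us_redcop us_prec1 us_succ1 addr0. Qed.

(** On the kernel of the counit, the coproduct differs from the reduced one by [c \ox 1 + 1 \ox c],
    which is killed since [f] and [g] vanish at 1. *)
Fact lmulE f g : f \in lfil 1 -> g \in lfil 1 ->
  f * g = lconv (us_prec H) f g + lconv (us_succ H) f g.
Proof.
move=> /lfil1P f1 /lfil1P g1; apply: linmap_ext => [|c c0].
  rewrite lconv_redcop [RHS](@lconv_at1 (us_redcop H) f g redcop1) -[LHS]/(Defs.mulA (tmap f g (us_cop H 1))).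
  by rewrite us_cop1 mulA_tmap_pure /= f1 mul0r.
rewrite -[LHS]/(Defs.mulA (tmap f g (us_cop H c))) us_copE //.
by rewrite !linearD /= !mulA_tmap_pure /= f1 g1 mul0r mulr0 !addr0.
Qed.

Fact lprecA f g h :
  lconv (us_prec H) (lconv (us_prec H) f g) h =
  lconv (us_prec H) f (lconv (us_prec H) g h + lconv (us_succ H) g h).
Proof.
rewrite lconv_redcop; apply: linmap_ext => [|c c0].
  by rewrite !lconv_at1 ?us_prec1.
by apply: convolveA; exact: us_prec_prec.
Qed.

Fact lsuccprecA f g h :
  lconv (us_prec H) (lconv (us_succ H) f g) h =
  lconv (us_succ H) f (lconv (us_prec H) g h).
Proof.
apply: linmap_ext => [|c c0].
  by rewrite !lconv_at1 ?us_prec1 ?us_succ1.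
by apply: convolveA; exact: us_succ_prec.
Qed.

Fact lsuccA f g h :
  lconv (us_succ H) (lconv (us_prec H) f g + lconv (us_succ H) f g) h =
  lconv (us_succ H) f (lconv (us_succ H) g h).
Proof.
rewrite lconv_redcop; apply: linmap_ext => [|c c0].
  by rewrite !lconv_at1 ?us_succ1.
by apply: convolveA; exact: us_redcop_succ.
Qed.

Definition lin_dendriform : dendriform U := Dendriform lfil_closed lfil0 lfilS
  lfil_sep lfilM lfil_prec lfil_succ lsumP lmulE lprecA lsuccprecA lsuccA.

End ConvolutionAlgebra.

(** * Characters *)

Section TensorProductAlgebra.
Variables (k : fieldType) (R S : algType k).

Fact tmul_inl (a : R) (b : S) (d : S) : linear (fun c : R => (a * c) \ox (b * d)).
Proof. by move=> x c c'; rewrite mulrDr -scalerAr pure_tens_linearl. Qed.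

Fact tmul_inr (a : R) (b : S) (c : R) : linear (fun d : S => (a * c) \ox (b * d)).
Proof. by move=> x d d'; rewrite mulrDr -scalerAr pure_tens_linearr. Qed.

Fact tmul_outl (t : tens R S) (b : S) :
  linear (fun a : R => tlift (fun c d => (a * c) \ox (b * d)) t).
Proof.
move=> x a a'; elim/tens_ind: t => s.
rewrite !(tlift_class (tmul_inl _ _) (tmul_inr _ _)) scaler_sumr -big_split.
by apply: eq_bigr => p _; rewrite /= mulrDl -scalerAl pure_tens_linearl.
Qed.

Fact tmul_outr (t : tens R S) (a : R) :
  linear (fun b : S => tlift (fun c d => (a * c) \ox (b * d)) t).
Proof.
move=> x b b'; elim/tens_ind: t => s.
rewrite !(tlift_class (tmul_inl _ _) (tmul_inr _ _)) scaler_sumr -big_split.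
by apply: eq_bigr => p _; rewrite /= mulrDl -scalerAl pure_tens_linearr.
Qed.

Lemma tmul_purel (a : R) (b : S) (t : tens R S) :
  tmul (a \ox b) t = tlift (fun c d => (a * c) \ox (b * d)) t.
Proof. exact: (tlift_pure (tmul_outl t) (tmul_outr t)). Qed.

Lemma tmul_pure (a c : R) (b d : S) : tmul (a \ox b) (c \ox d) = (a * c) \ox (b * d).
Proof. by rewrite tmul_purel (tlift_pure (tmul_inl a b) (tmul_inr a b)). Qed.

Lemma tmul_linearl (t : tens R S) : linear (fun s : tens R S => tmul s t).
Proof. exact: (tlift_linear (tmul_outl t) (tmul_outr t)). Qed.

Lemma tmul_pure_linearr (a : R) (b : S) : linear (fun t : tens R S => tmul (a \ox b) t).
Proof.
move=> x t t'; rewrite !tmul_purel.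
exact: (tlift_linear (tmul_inl a b) (tmul_inr a b)).
Qed.

Definition tmulr (t s : tens R S) := tmul s t.

HB.instance Definition _ t := GRing.isLinear.Build k _ _ *:%R
  (tmulr t) (tmul_linearl t).

Definition tmul_pl (a : R) (b : S) (t : tens R S) := tmul (a \ox b) t.

HB.instance Definition _ a b := GRing.isLinear.Build k _ _ *:%R
  (tmul_pl a b) (tmul_pure_linearr a b).

End TensorProductAlgebra.

(** * Exponentials of infinitesimal characters are characters *)

Section Characters.
Variables (k : fieldType) (B : algType k) (H : unshuffle_bialg B).
Variable A : comAlgType k.
Local Notation U := (linmap A H).
Implicit Types (a f g h p q : U).
Local Notation S := (lin_dendriform H A).
Local Notation "f '<~' g" := (dprec S f g) (at level 45, left associativity).
Local Notation "f '~>' g" := (dsucc S f g) (at level 45, left associativity).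

(** On pure tensors this is f(v v') g(w w') = (f v g w) (f v' g w'), where the commutativity of [A]
    enters. *)
Lemma character_mul f g : character f -> character g -> character (f * g : U).
Proof.
move=> [_ f1 fM] [_ g1 gM]; split; first exact: linmap_linear.
  by rewrite -[LHS]/(Defs.mulA (tmap f g (us_cop H 1))) us_cop1 mulA_tmap_pure /=
    f1 g1 mulr1.
move=> x y; rewrite -[LHS]/(Defs.mulA (tmap f g (us_cop H (x * y)))) us_copM.
rewrite -[RHS]/(Defs.mulA (tmap f g (us_cop H x)) * Defs.mulA (tmap f g (us_cop H y))).
move: (us_cop H x) (us_cop H y) => s t.
apply: (@tens_ext _ _ _ _ (@Defs.mulA k A \o tmap f g \o tmulr t)
  (Defs.mulA (tmap f g t) \o* (@Defs.mulA k A \o tmap f g))) => v w.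
rewrite /= mulA_tmap_pure.
apply: (@tens_ext _ _ _ _ (@Defs.mulA k A \o tmap f g \o tmul_pl v w)
  ((f v * g w) \*o (@Defs.mulA k A \o tmap f g))) => v' w' /=.
by rewrite /tmul_pl tmul_pure !mulA_tmap_pure /= fM gM mulrACA.
Qed.

Lemma linmap_gr0 f : (forall n x, x \in us_gr H n -> f x = 0) -> f = 0.
Proof. by move=> f0; apply: (@lfil_sep _ _ H A) => n; apply/lfilP => i x _; exact: f0. Qed.

(** In positive degree, both legs of [us_prec] have positive degree, where the augmentation
    vanishes. *)
Lemma dprec1 f : f <~ 1 = 0.
Proof.
apply: linmap_gr0 => -[|n] x xG.
  have /us_gr0P[c ->] := xG.
  by rewrite linearZZ /= /convolve us_prec1 !linear0.
apply: (tspan_eq0 (h := @Defs.mulA k A \o tmap f (1 : U)) (us_prec_gr xG)).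
move=> v w [i [j [_ _ wj]]]; rewrite /= mulA_tmap_pure /=.
by rewrite aug_counit0 ?mulr0 // (us_counit_gr wj).
Qed.

Lemma dsucc1 f : 1 ~> f = 0.
Proof.
apply: linmap_gr0 => -[|n] x xG.
  have /us_gr0P[c ->] := xG.
  by rewrite linearZZ /= /convolve us_succ1 !linear0.
apply: (tspan_eq0 (h := @Defs.mulA k A \o tmap (1 : U) f) (us_succ_gr xG)).
move=> v w [i [j [_ vi _]]]; rewrite /= mulA_tmap_pure /=.
by rewrite aug_counit0 ?mul0r // (us_counit_gr vi).
Qed.

Lemma inf_char_mul a (v c : B) : inf_char H a -> us_counit H v = 0 ->
  a (v * c) = us_counit H c *: a v.
Proof.
move=> [_ _ a0] v0.
have /eqP := a0 _ _ v0 (counit_sub H c).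
by rewrite mulrBr linearB -scalerAr mulr1 linearZZ subr_eq0 => /eqP.
Qed.

(** Strong induction on the degree of the left factor, for all right factors at once. Removing its
    scalar part puts the right factor in the kernel of the counit. *)
Lemma character_gr f : f 1 = 1 ->
  (forall n (x y : B), x \in us_gr H n.+1 -> us_counit H y = 0 ->
    (forall m (x' y' : B), (m <= n)%N -> x' \in us_gr H m -> f (x' * y') = f x' * f y') ->
    f (x * y) = f x * f y) ->
  character f.
Proof.
move=> f1 IH; have fgr n : forall x y : B, x \in us_gr H n -> f (x * y) = f x * f y.
  elim/ltn_ind: n => -[|n] IHn x y xG.
    have /us_gr0P[c ->] := xG.
    by rewrite -scalerAl mul1r !linearZZ /= f1 mulr_algl.
  have := IH n x _ xG (counit_sub H y) (fun m x' y' mn => IHn m mn x' y').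
  rewrite mulrBr -scalerAr mulr1 !linearB !linearZZ /= f1 !scalerN mulrBr mulr_algr.
  exact: addIr.
split=> [|//|x y]; first exact: linmap_linear.
have [_ dec _] := us_grP H; have [N [z [zG ->]]] := dec x.
by rewrite mulr_suml !linear_sum mulr_suml; apply: eq_bigr => i _; exact: fgr.
Qed.

Lemma mulA_precp a f c : f 1 = 1 ->
  Defs.mulA (tmap a f (us_precp H c)) = a c + (a <~ f) c.
Proof.
by move=> f1; rewrite /us_precp !linearD /= mulA_tmap_pure /= f1 mulr1 addrC.
Qed.

Lemma mulA_succp a f c : f 1 = 1 ->
  Defs.mulA (tmap f a (us_succp H c)) = a c + (f ~> a) c.
Proof.
by move=> f1; rewrite /us_succp !linearD /= mulA_tmap_pure /= f1 mul1r addrC.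
Qed.

(** By [inf_char_mul], [a] sees the left leg of the coproduct of [y] only through the counit, and
    the counit axiom then restores [y] in the right leg. *)
Lemma mulA_tmull a f v w y : inf_char H a -> us_counit H v = 0 ->
  Defs.mulA (tmap a f (tmul (v \ox w) (us_cop H y))) = a v * f (w * y).
Proof.
move=> ha v0.
have bl (d : B) : linear (fun c : B => us_counit H c *: d).
  by move=> x c c'; rewrite linearP scalerDl scalerA.
have br (c : B) : linear (fun d : B => us_counit H c *: d).
  by move=> x d d'; rewrite scalerDr !scalerA mulrC.
pose e := HB.pack_for {linear tens B B -> B} (tlift (fun c d => us_counit H c *: d))
  (GRing.isLinear.Build k _ _ *:%R _ (tlift_linear bl br)).
rewrite -[in RHS](us_cop_counitl H y).
apply: (@tens_ext _ _ _ _ (@Defs.mulA k A \o tmap a f \o tmul_pl v w)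
  (a v \*o (f \o (w \*o e)))) => c d.
rewrite /= /tmul_pl tmul_pure mulA_tmap_pure /= tlift_pure //.
by rewrite (inf_char_mul _ ha v0) -scalerAr linearZZ -scalerAl scalerAr.
Qed.

Lemma mulA_tmulr a f v w y : inf_char H a -> us_counit H w = 0 ->
  Defs.mulA (tmap f a (tmul (v \ox w) (us_cop H y))) = f (v * y) * a w.
Proof.
move=> ha w0.
have bl (d : B) : linear (fun c : B => us_counit H d *: c).
  by move=> x c c'; rewrite scalerDr !scalerA mulrC.
have br (c : B) : linear (fun d : B => us_counit H d *: c).
  by move=> x d d'; rewrite linearP scalerDl scalerA.
pose e := HB.pack_for {linear tens B B -> B} (tlift (fun c d => us_counit H d *: c))
  (GRing.isLinear.Build k _ _ *:%R _ (tlift_linear bl br)).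
rewrite -[in RHS](us_cop_counitr H y).
apply: (@tens_ext _ _ _ _ (@Defs.mulA k A \o tmap f a \o tmul_pl v w)
  (a w \o* (f \o (v \*o e)))) => c d.
rewrite /= /tmul_pl tmul_pure mulA_tmap_pure /= tlift_pure //.
by rewrite (inf_char_mul _ ha w0) -[in RHS]scalerAr linearZZ -scalerAl scalerAr.
Qed.

(** The fixed point equation turns f(xy) into the value of a \ox f on [us_precp x] times the
    coproduct of [y]. By [mulA_tmull], a term [v \ox w] contributes a(v) f(wy), where [w] has
    smaller degree than [x]. *)
Lemma character_prec a f : inf_char H a -> f 1 = 1 ->
  (forall c, us_counit H c = 0 -> f c = a c + (a <~ f) c) -> character f.
Proof.
move=> ha f1 fE; apply: character_gr => // n x y xG y0 IH.
have x0 := us_counit_gr xG.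
have tmulE v w : us_counit H v = 0 -> f (w * y) = f w * f y ->
    Defs.mulA (tmap a f (tmul (v \ox w) (us_cop H y))) =
    Defs.mulA (tmap a f (v \ox w)) * f y.
  by move=> v0 wy; rewrite mulA_tmull // wy mulrA mulA_tmap_pure.
rewrite (fE (x * y)) ?(fE x) ?us_counitM ?x0 ?mul0r // -!mulA_precp // us_precpM //.
apply/eqP; rewrite -subr_eq0; apply/eqP.
(* The defect of multiplicativity, as a linear map of the tensor; it is checked on the terms of
   [us_prec x] by induction and on [x \ox 1] by [f 1 = 1]. *)
pose h : {linear tens B B -> A} :=
  (@Defs.mulA k A \o tmap a f \o tmulr (us_cop H y)) \-
  (f y \o* (@Defs.mulA k A \o tmap a f)).
suff: h (us_prec H x + x \ox 1) = 0 by [].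
rewrite linearD [X in _ + X](_ : _ = 0).
  rewrite addr0; apply: (tspan_eq0 (us_prec_gr xG)).
  move=> v w [i [j [ij vi wj]]]; apply/eqP; rewrite subr_eq0; apply/eqP.
  apply: tmulE; first exact: us_counit_gr vi.
  by apply: (IH j.+1) => //; case: ij => <-; exact: leq_addl.
by apply/eqP; rewrite subr_eq0; apply/eqP/tmulE => //; rewrite mul1r f1 mul1r.
Qed.

(** Mirror image of [character_prec]: [f] acts on the left legs, and the induction is applied to
    those. *)
Lemma character_succ a f : inf_char H a -> f 1 = 1 ->
  (forall c, us_counit H c = 0 -> f c = a c + (f ~> a) c) -> character f.
Proof.
move=> ha f1 fE; apply: character_gr => // n x y xG y0 IH.
have x0 := us_counit_gr xG.
have tmulE v w : us_counit H w = 0 -> f (v * y) = f v * f y ->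
    Defs.mulA (tmap f a (tmul (v \ox w) (us_cop H y))) =
    Defs.mulA (tmap f a (v \ox w)) * f y.
  by move=> w0 vy; rewrite mulA_tmulr // vy mulrAC mulA_tmap_pure.
rewrite (fE (x * y)) ?(fE x) ?us_counitM ?x0 ?mul0r // -!mulA_succp // us_succpM //.
apply/eqP; rewrite -subr_eq0; apply/eqP.
pose h : {linear tens B B -> A} :=
  (@Defs.mulA k A \o tmap f a \o tmulr (us_cop H y)) \-
  (f y \o* (@Defs.mulA k A \o tmap f a)).
suff: h (us_succ H x + 1 \ox x) = 0 by [].
rewrite linearD [X in _ + X](_ : _ = 0).
  rewrite addr0; apply: (tspan_eq0 (us_succ_gr xG)).
  move=> v w [i [j [ij vi wj]]]; apply/eqP; rewrite subr_eq0; apply/eqP.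
  apply: tmulE; first exact: us_counit_gr wj.
  by apply: (IH i.+1) => //; case: ij => <-; rewrite addnS ltnS leq_addr.
by apply/eqP; rewrite subr_eq0; apply/eqP/tmulE => //; rewrite mul1r f1 mul1r.
Qed.

Lemma lfil1D1 p : p \in lfil 1 -> (1 + p) 1 = 1.
Proof. by move=> /lfil1P p1; rewrite -[LHS]/(aug H A 1 + p 1) aug1 p1 addr0. Qed.

Lemma character_dEprec a : inf_char H a -> character (1 + dEprec S a).
Proof.
move=> ha; have a1 : a \in dfil S 1 by apply/lfil1P; case: ha.
have p1 := dEprec_fil a1; apply: (character_prec ha) => [|c c0].
  exact: lfil1D1.
rewrite linearDr dprec1 add0r -[LHS]/(aug H A c + dEprec S a c).
by rewrite aug_counit0 // add0r {1}(dEprecE a1).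
Qed.

Lemma character_dEsucc a : inf_char H a -> character (1 + dEsucc S a).
Proof.
move=> ha; have a1 : a \in dfil S 1 by apply/lfil1P; case: ha.
have p1 := dEsucc_fil a1; apply: (character_succ ha) => [|c c0].
  exact: lfil1D1.
rewrite linearDl dsucc1 add0r -[LHS]/(aug H A c + dEsucc S a c).
by rewrite aug_counit0 // add0r {1}(dEsuccE a1).
Qed.

End Characters.

(** * The constructions on maps as dendriform constructions *)

Section Transport.
Variables (k : fieldType) (B : algType k) (H : unshuffle_bialg B).
Variable A : comAlgType k.
Local Notation U := (linmap A H).
Implicit Types (a b f g h p q : U).
Local Notation S := (lin_dendriform H A).
Local Notation F := (dfil S).
Local Notation "f '<~' g" := (dprec S f g) (at level 45, left associativity).
Local Notation "f '~>' g" := (dsucc S f g) (at level 45, left associativity).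

Lemma lfsum_dsum (u : nat -> U) (w : nat -> B -> A) :
  (forall n, u n \in F n) -> (forall n, w n = u n) -> lfsum w = dsum S u.
Proof.
by move=> uF wu; rewrite [RHS](lsumE uF); congr lfsum; apply/funext.
Qed.

Lemma Eprec_val a : a \in F 1 -> Eprec H a = (1 + dEprec S a : U).
Proof.
move=> a1; congr (_ + _); apply: lfsum_dsum => n.
  exact/dfilS/iter_prec_fil.
by elim: n => //= n; rewrite /prec_pow /= => ->.
Qed.

Lemma Esucc_val a : a \in F 1 -> Esucc H a = (1 + dEsucc S a : U).
Proof.
move=> a1; congr (_ + _); apply: lfsum_dsum => n.
  exact/dfilS/iter_succ_fil.
by elim: n => //= n; rewrite /succ_pow /= => ->.
Qed.

Lemma conv_pow_val b n : conv_pow H b n = (b ^+ n : U).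
Proof.
elim: n => // n; rewrite exprS /conv_pow iterS => ->; by [].
Qed.

Lemma conv_exp_val b : b \in F 1 -> conv_exp H b = (1 + dexp S b : U).
Proof.
move=> b1; congr (_ + _); apply: lfsum_dsum => n; first exact/dfilS/dexp_fil.
by rewrite conv_pow_val.
Qed.

Lemma subr_aug f : linval (1 + f) - aug H A = f.
Proof. by rewrite -[LHS]/(linval ((1 + f) - 1)) addrAC subrr add0r. Qed.

Lemma conv_log_val f : f \in F 1 -> conv_log H (1 + f : U) = dlog S f.
Proof.
move=> f1; rewrite /conv_log subr_aug; congr (- _).
apply: lfsum_dsum => n; first exact/dfilS/dlog_fil_term.
by rewrite conv_pow_val.
Qed.

Lemma iter_prelie_val b a n : iter n (prelie H b) a = (iter n (dL S b) a : U).
Proof. by elim: n => //= n ->. Qed.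

Lemma Wmap_val b : b \in F 1 -> Wmap H b = dW S b.
Proof.
move=> b1; apply: lfsum_dsum => n; first exact/dfilS/dW_fil.
by rewrite iter_prelie_val.
Qed.

(** Whatever solution [xget] selects satisfies [is_Omega]; the default value is excluded because the
    logarithm of [1 + dEprec S a] is a solution. *)
Lemma Omega'_val (k0 : [pchar k] =i pred0) a : a \in F 1 ->
  exists b, [/\ b \in F 1, is_Omega S a b & Omega' H a = b].
Proof.
move=> a1.
have sumE b : b \in F 1 ->
    lfsum (fun m => (bernoulli k m / m`!%:R) *: iter m (prelie H b) a) =
    dsum S (fun m => (bernoulli k m / m`!%:R) *: iter m (dL S b) a).
  move=> b1; apply: lfsum_dsum => n; last by rewrite iter_prelie_val.
  by rewrite rpredZ //; have := iter_dL_fil n b1 (dfil0 S a); rewrite addn0.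
rewrite /Omega'; case: xgetP => [X _ [[Xl X1] XE]|noX].
  pose b := mk_linmap H Xl; have b1 : b \in F 1 by apply/lfil1P.
  exists b; split=> //; apply: val_inj; rewrite /= {1}XE.
  exact: (sumE b b1).
have b1 := dlog_fil (dEprec_fil a1); set b := dlog S _ in b1.
case: (noX b); split; last by rewrite sumE // -{1}(is_Omega_dlog k0 a1).
by split; [exact: linmap_linear|exact/lfil1P].
Qed.

(** [xget] searches among characters only, so the inverse [g] must be known to be one; uniqueness of
    inverses does the rest. *)
Lemma conv_inv_val f g : character g -> f * g = 1 -> g * f = 1 ->
  conv_inv H f = g.
Proof.
move=> gc fg gf; apply: xget_unique.
  by split; rewrite //= ; [rewrite -[LHS]/(linval (f * g)) fg|rewrite -[LHS]/(linval (g * f)) gf].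
move=> h [[hl h1 hM] fh hf]; pose h' := mk_linmap H hl.
have hf' : h' * f = 1 by exact: val_inj.
by rewrite -[h]/(linval h') -[h']mulr1 -fg mulrA hf' mul1r.
Qed.

Lemma reduced_val f : f \in F 1 -> reduced H f = f.
Proof. by move=> /lfil1P f1; apply/funext => x; rewrite /reduced f1 mul0r subr0. Qed.

Lemma reduced1_val f : f \in F 1 -> reduced H (1 + f : U) = f.
Proof.
move=> f1; apply/funext => x; rewrite /reduced lfil1D1 // mul1r.
by rewrite -[LHS]/((linval (1 + f) - aug H A) x) subr_aug.
Qed.

Section Inverse.
Variables f g : U.
Hypotheses (f1 : f \in F 1) (g1 : g \in F 1) (gc : character (1 + g : U)).
Hypotheses (fg : (1 + f) * (1 + g) = 1) (gf : (1 + g) * (1 + f) = 1).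

Lemma log_prec_val : log_prec H (1 + f : U) = (f + f <~ g : U).
Proof.
rewrite /log_prec subr_aug (conv_inv_val gc fg gf) /xprec (reduced_val f1).
rewrite (reduced1_val g1) (lfil1D1 g1).
by apply/funext => x; rewrite mul1r addrC.
Qed.

Lemma log_succ_val : log_succ H (1 + f : U) = (f + g ~> f : U).
Proof.
rewrite /log_succ subr_aug (conv_inv_val gc fg gf) /xsucc (reduced_val f1).
rewrite (reduced1_val g1) (lfil1D1 g1).
by apply/funext => x; rewrite mul1r addrC.
Qed.

End Inverse.

Lemma inf_charN a : inf_char H a -> inf_char H (- a : U).
Proof.
move=> [al a1 aM]; split; first exact: linmap_linear.
  by rewrite -[LHS]/(- a 1) a1 oppr0.
by move=> x y x0 y0; rewrite -[LHS]/(- a (x * y)) aM ?oppr0.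
Qed.

Lemma inf_char_fil a : inf_char H a -> a \in F 1.
Proof. by case=> _ a1 _; apply/lfil1P. Qed.

Lemma dfil1_mul1D p q : p \in F 1 -> q \in F 1 -> p + q + p * q \in F 1.
Proof.
move=> p1 q1; rewrite !rpredD //.
by apply: (@dfil_le _ _ S _ 2) => //; exact: (@dfilM _ _ S 1 1).
Qed.

End Transport.

(** * Products of half-exponentials and their logarithms *)

Theorem lemma27 (k : fieldType) (k0 : [pchar k] =i pred0)
    (B : algType k) (H : unshuffle_bialg B) (A : comAlgType k)
    (g1 g2 : B -> A) (hg1 : inf_char H g1) (hg2 : inf_char H g2) :
  sharp H g1 g2 = Wmap H (BCH H (Omega' H g1) (Omega' H g2)) /\
  odot H g1 g2 = - sharp H (- g2) (- g1).
Proof.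
have [g1l _ _] := hg1; have [g2l _ _] := hg2.
pose a1 : linmap A H := mk_linmap H g1l; pose a2 : linmap A H := mk_linmap H g2l.
rewrite -[g1]/(linval a1) -[g2]/(linval a2) in hg1 hg2 *.
move: a1 a2 hg1 hg2 => {g1 g2 g1l g2l} a1 a2 ha1 ha2.
have [hn1 hn2] := (inf_charN ha1, inf_charN ha2).
have [F1 F2] := (inf_char_fil ha1, inf_char_fil ha2).
have [N1 N2] := (inf_char_fil hn1, inf_char_fil hn2).
set S := lin_dendriform H A.
have inv a : a \in dfil S 1 ->
    (1 + dEprec S a) * (1 + dEsucc S (- a)) = 1 /\
    (1 + dEsucc S (- a)) * (1 + dEprec S a) = 1.
  move=> aF; have ga := dEsuccN_Eprec aF; split=> //; move: ga.
  by apply: linv_rinv; [exact: dEprec_fil|apply: dEsucc_fil; rewrite rpredN].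
have inv_mul (x x' y y' : linmap A H) :
    x * x' = 1 -> y * y' = 1 -> x * y * (y' * x') = 1.
  by move=> xx yy; rewrite mulrA -(mulrA x) yy mulr1.
split.
  rewrite /sharp /BCH !Eprec_val //.
  have [b1 [B1 O1 ->]] := Omega'_val k0 F1; have [b2 [B2 O2 ->]] := Omega'_val k0 F2.
  rewrite !conv_exp_val // (dexp_Omega k0 F1 B1 O1) (dexp_Omega k0 F2 B2 O2).
  set p1 := dEprec S a1; set p2 := dEprec S a2.
  rewrite -[conv _ _ _]/(linval ((1 + p1) * (1 + p2))).
  have [i1 i1'] := inv _ F1; have [i2 i2'] := inv _ F2.
  have fg := inv_mul _ _ _ _ i1 i2; have gf := inv_mul _ _ _ _ i2' i1'.
  (* The inverse of the product of the two [Eprec] is the product, in reverse order, of the [Esucc]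
     of the opposites. *)
  have gc := character_mul (character_dEsucc hn2) (character_dEsucc hn1).
  have [P1 P2] : p1 \in dfil S 1 /\ p2 \in dfil S 1 by split; exact: dEprec_fil.
  have [Q1 Q2] := (dEsucc_fil N1, dEsucc_fil N2).
  rewrite (dmul1D p1 p2) (dmul1D (dEsucc S (- a2))) in fg gf.
  rewrite dmul1D in gc; rewrite dmul1D.
  have [f1 g1] := (dfil1_mul1D P1 P2, dfil1_mul1D Q2 Q1).
  rewrite (log_prec_val f1 g1 gc fg gf) conv_log_val // Wmap_val ?dlog_fil //.
  by rewrite (log_prec_dW k0 f1 g1 fg).
rewrite /odot /sharp.
rewrite -[- linval a1]/(linval (- a1)) -[- linval a2]/(linval (- a2)).
rewrite !Esucc_val // !Eprec_val //.
set q1 := dEsucc S a1; set q2 := dEsucc S a2.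
set p1 := dEprec S (- a1); set p2 := dEprec S (- a2).
rewrite -[conv _ (linval (1 + q1)) _]/(linval ((1 + q1) * (1 + q2))).
rewrite -[conv _ _ _]/(linval ((1 + p2) * (1 + p1))).
have [i1 i1'] := inv _ N1; have [i2 i2'] := inv _ N2.
rewrite opprK in i1 i1'; rewrite opprK in i2 i2'.
have fg := inv_mul _ _ _ _ i1' i2'; have gf := inv_mul _ _ _ _ i2 i1.
(* The elements [1 + f] and [1 + g] below are inverse to each other. One logarithm is taken of each,
   so both must be characters. *)
have gc := character_mul (character_dEprec hn2) (character_dEprec hn1).
have fc := character_mul (character_dEsucc ha1) (character_dEsucc ha2).
have [P1 P2] := (dEprec_fil N1, dEprec_fil N2).
have [Q1 Q2] := (dEsucc_fil F1, dEsucc_fil F2).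
rewrite (dmul1D q1 q2) (dmul1D p2 p1) in fg gf.
rewrite dmul1D in gc; rewrite dmul1D in fc; rewrite (dmul1D q1 q2) (dmul1D p2 p1).
have [f1 g1] := (dfil1_mul1D Q1 Q2, dfil1_mul1D P2 P1).
rewrite (log_succ_val f1 g1 gc fg gf) (log_prec_val g1 f1 fc gf fg).
set f := q1 + q2 + q1 * q2 in f1 gf *; set g := p2 + p1 + p2 * p1 in g1 gf *.
rewrite -[RHS]/(linval (- (g + dprec S g f))); congr linval.
(* The two logarithms are [f + g ~> f] and [g + g <~ f]; their sum is [g + f + g * f], which is 0 as
   [(1 + g) * (1 + f) = 1]. *)
apply/eqP; rewrite -addr_eq0 addrACA; apply/eqP.
have /eqP := gf; rewrite dmul1D -[X in _ == X]addr0 => /eqP/addrI <-.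
by rewrite (dmulE g1 f1) (addrC f) [in RHS](addrC (dprec S g f)).
Qed.
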